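(* Let $k$ be a field, $n\ge1$, $R=k[t_1^{\pm},\ldots,t_n^{\pm}]$ and $\mathfrak{G}=E^n(k)_{Lie}$, with $R\hookrightarrow E^n(k)$ by multiplication operators. The residue formula $$f_0\,\mathrm{d}f_1\wedge\cdots\wedge\mathrm{d}f_n\ \mapsto\ (-1)^n\operatorname{tr}\sum_{\pi\in\mathfrak{S}_n}\operatorname{sgn}(\pi)\sum_{\gamma_1,\ldots,\gamma_n\in\{\pm\}}(-1)^{\gamma_1+\cdots+\gamma_n}\big(P_1^{-\gamma_1}\operatorname{ad}(f_{\pi(1)})P_1^{\gamma_1}\big)\cdots\big(P_n^{-\gamma_n}\operatorname{ad}(f_{\pi(n)})P_n^{\gamma_n}\big)f_0$$ $(f_0,\ldots,f_n\in R)$ arises from Beilinson's construction, i.e. it is the composition $$\Omega^n_{R/k}\xrightarrow{(-1)^n\varkappa}H_{n+1}(\mathfrak{G},k)\xrightarrow{\rho_2}{}^{\wedge}E^{n+1}_{0,n+1}\xrightarrow{(d_{n+1})^{-1}}{}^{\wedge}E^{n+1}_{n+1,1}\xrightarrow{\rho_1}H_0(\mathfrak{G},N^{n+1})\xrightarrow{\operatorname{tr}}k,$$ where $\varkappa:f_0\,\mathrm{d}f_1\wedge\cdots\wedge\mathrm{d}f_n\mapsto f_0\wedge f_1\wedge\cdots\wedge f_n$, $N^{n+1}=I_{\operatorname{tr}}$, and $\rho_1,\rho_2$ are the edge maps and $d_{n+1}$ the differential on the $(n+1)$-th page of the spectral sequence ${}^{\wedge}E$ described in the context.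
   Context: Since $R$ is commutative, $f_0\wedge\cdots\wedge f_n$ is a Lie cycle. $\varkappa$ is prescribed on the symbols $f_0\,\mathrm{d}f_1\wedge\cdots\wedge\mathrm{d}f_n$; it does not itself respect the Leibniz relation, but this ambiguity disappears after composing with the remaining maps. So the statement is the equality of values for all $f_0,\ldots,f_n\in R$. Infinite matrix algebras. For an associative $k$-algebra $S$ let $E(S)$ be the algebra of matrices $(\phi_{ij})_{i,j\in\mathbf{Z}}$, $\phi_{ij}\in S$, for which there is $K$ with $\phi_{ij}=0$ whenever $|i-j|>K$. Let $I^{+}(S)$ (resp. $I^{-}(S)$) be the two-sided ideal of those $\phi\in E(S)$ for which there is $B$ with $\phi_{ij}=0$ for all $i<B$ (resp. for all $j>B$); on $I^{0}(S)=I^{+}(S)\cap I^{-}(S)$ (finitely many nonzero entries) let $\operatorname{tr}\phi=\sum_i\phi_{ii}$. Put $A=E^{n}(k)$, $\mathfrak{G}=A_{Lie}$ (commutator bracket); $A$ acts on $k[\mathbf{t}_1^{\pm},\ldots,\mathbf{t}_n^{\pm}]$ by matrices in the monomial basis, the $i$-th place (counted from the inside) corresponding to powers of $\mathbf{t}_i$. Let $I_i^{\pm}\subseteq A$ be the ideal obtained by applying $E$ in all places except the $i$-th, where $I^{\pm}$ is applied. Put $I_i^0=I_i^+\cap I_i^-$, $I_{\operatorname{tr}}=I_1^0\cap\cdots\cap I_n^0$; $\operatorname{tr}:I_{\operatorname{tr}}\to k$ is the $n$-fold iterated trace; it vanishes on $[I_{\operatorname{tr}},\mathfrak{G}]$,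 hence factors over $H_0(\mathfrak{G},I_{\operatorname{tr}})=I_{\operatorname{tr}}/[I_{\operatorname{tr}},\mathfrak{G}]$. Projectors: $P_j^+\mathbf{t}_1^{\lambda_1}\cdots\mathbf{t}_n^{\lambda_n}=\mathbf{t}_1^{\lambda_1}\cdots\mathbf{t}_n^{\lambda_n}$ if $\lambda_j\ge0$ and $0$ otherwise, $P_j^-=1-P_j^+$; they act on $A$ by left multiplication, $\operatorname{ad}(f)g=fg-gf$, and $(-1)^{\pm}=\pm1$. Spectral sequence. For a Lie ideal $\mathfrak{j}\subseteq\mathfrak{G}$ let $CE(\mathfrak{j})_0=k$ and, for $r\ge1$, $CE(\mathfrak{j})_r=\mathfrak{j}\wedge\bigwedge^{r-1}\mathfrak{G}\subseteq\bigwedge^r\mathfrak{G}$ (span of all $j\wedge g_1\wedge\cdots\wedge g_{r-1}$, $j\in\mathfrak{j}$), with differential $\delta(f_0\wedge\cdots\wedge f_r)=\sum_{0\le i<j\le r}(-1)^{i+j}[f_i,f_j]\wedge f_0\wedge\cdots\widehat{f_i}\cdots\widehat{f_j}\cdots\wedge f_r$. $CE(\mathfrak{G})_\bullet$ computes $H_\bullet(\mathfrak{G},k)$. For $s\in\{+,-,0\}^n$ put $\deg(s)=1+\#\{i: s_i=0\}$. Let ${}^{\wedge}T^0_\bullet=CE(\mathfrak{G})_\bullet$ and, for $1\le p\le n+1$, ${}^{\wedge}T^p_\bullet=\bigoplus_{\deg(s)=p}\bigcap_{i=1}^n X_i^{s_i}$, where $X_i^{\pm}=CE(I_i^{\pm})_\bullet$,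 $X_i^0=CE(I_i^+)_\bullet\cap CE(I_i^-)_\bullet$. Define $\partial:{}^{\wedge}T^{p}\to{}^{\wedge}T^{p-1}$ for $p\ge2$ by $(\partial f)_{s_1\ldots s_n}=\sum_{\{i: s_i=\pm\}}(-1)^{\#\{j>i: s_j=0\}}f_{s_1\ldots0\ldots s_n}$ ($0$ in the $i$-th place), and for $p=1$ by $\partial f=\sum_{s\in\{+,-\}^n}(-1)^{s_1+\cdots+s_n}f_s$. This is an exact complex of complexes; ${}^{\wedge}E$ is its bicomplex spectral sequence with ${}^{\wedge}E^1_{p,q}=H_q({}^{\wedge}T^p_\bullet)$, converging to $0$; $d_{n+1}:{}^{\wedge}E^{n+1}_{n+1,1}\to{}^{\wedge}E^{n+1}_{0,n+1}$ is an isomorphism, and $\rho_2:H_{n+1}(\mathfrak{G},k)={}^{\wedge}E^1_{0,n+1}\to{}^{\wedge}E^{n+1}_{0,n+1}$, $\rho_1:{}^{\wedge}E^{n+1}_{n+1,1}\to{}^{\wedge}E^1_{n+1,1}=I_{\operatorname{tr}}/[I_{\operatorname{tr}},\mathfrak{G}]$ are edge maps. Concretely (this fixes signs), for a cycle $\theta_0\in{}^{\wedge}T^0_{n+1}$ choose $\theta_i\in{}^{\wedge}T^i_{n+2-i}$ with $\partial\theta_1=\theta_0$, $\partial\theta_{i+1}=\delta\theta_i$ for $1\le i\le n$; then $\rho_1(d_{n+1})^{-1}\rho_2[\theta_0]$ is the class of $\theta_{n+1}\in I_{\operatorname{tr}}$. *)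

(* Defs.v *)
From HB Require Import structures.
From mathcomp Require Import all_boot all_order all_fingroup all_algebra.
From mathcomp Require Import generic_quotient ring_quotient.
From mathcomp Require Import boolp classical_sets functions cardinality fsbigop.
From mathcomp.multinomials Require Import freeg.

From mathcomp Require Import zify.
Set Implicit Arguments.
Unset Strict Implicit.
Unset Printing Implicit Defensive.
Import Order.TTheory GRing.Theory Num.Theory.
Local Open Scope classical_set_scope.
Local Open Scope ring_scope.
Local Open Scope quotient_scope.

Section Quotients.
Variables (k : fieldType) (V : lmodType k).

Inductive span (A : set V) : V -> Prop :=
| span0 : span A 0
| spanD a x y : A x -> span A y -> span A (a *: x + y).

Definition spanp (A : set V) : {pred V} := fun x => `[< span A x >].

Lemma span_sub (A : set V) x y : span A x -> span A y -> span A (x - y).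
Proof.
move=> Ax; elim=> [|a z t Az _ IH]; first by rewrite subr0.
by rewrite opprD addrCA -scaleNr; apply: spanD.
Qed.

Lemma span_scale (A : set V) a x : span A x -> span A (a *: x).
Proof.
elim=> [|b y z Ay _ IH]; first by rewrite scaler0; apply: span0.
by rewrite scalerDr scalerA; apply: spanD.
Qed.

Lemma spanp_zmod_closed (A : set V) : zmod_closed (spanp A).
Proof.
split=> [|x y /asboolP Ax /asboolP Ay]; apply/asboolP; first exact: span0.
exact: span_sub.
Qed.

HB.instance Definition _ (A : set V) :=
  GRing.isZmodClosed.Build V (spanp A) (spanp_zmod_closed A).

(* The quotient of V by the subspace spanned by A. *)
Definition vquot (A : set V) : Type := (Quotient.quot (spanp A)).
HB.instance Definition _ (A : set V) := Quotient.on (vquot A).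
HB.instance Definition _ (A : set V) := GRing.Zmodule.on (vquot A).

Section Scale.
Variable A : set V.
Local Notation Q := (vquot A).
Definition vpi (x : V) : Q := \pi_(Quotient.quot (spanp A)) x.

Lemma vpi_eqP x y : reflect (vpi x = vpi y) (spanp A (x - y)).
Proof.
have := Quotient.idealrBE (spanp A : zmodClosed V) x y.
by rewrite /in_mem /= => ->; apply: eqP.
Qed.

Lemma vpi_repr (u : Q) : vpi (repr u) = u.
Proof. exact: reprK. Qed.

Lemma vpiD x y : vpi (x + y) = vpi x + vpi y.
Proof. exact: (raddfD \pi_(Quotient.quot (spanp A))). Qed.

Definition vscale (a : k) (u : Q) : Q := vpi (a *: repr u).

Lemma vpi_scale a x : vpi (a *: x) = vscale a (vpi x).
Proof.
apply/vpi_eqP/asboolP; rewrite -scalerBr; apply: span_scale.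
by apply/asboolP/vpi_eqP; rewrite vpi_repr.
Qed.

Lemma vscaleA a b u : vscale a (vscale b u) = vscale (a * b) u.
Proof. by rewrite -[u]vpi_repr -!vpi_scale scalerA. Qed.
Lemma vscale1 : left_id 1 vscale.
Proof. by move=> u; rewrite -[u]vpi_repr -vpi_scale scale1r. Qed.
Lemma vscaleDr : right_distributive vscale +%R.
Proof.
move=> a u v; rewrite -[u]vpi_repr -[v]vpi_repr -vpiD -!vpi_scale scalerDr.
exact: vpiD.
Qed.
Lemma vscaleDl u : {morph vscale^~ u : a b / a + b}.
Proof. by move=> a b; rewrite -[u]vpi_repr -!vpi_scale scalerDl vpiD. Qed.
HB.instance Definition _ :=
  GRing.Zmodule_isLmodule.Build k (vquot A) vscaleA vscale1 vscaleDr vscaleDl.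

Lemma vpi_linear : linear vpi.
Proof. by move=> a x y; rewrite vpiD vpi_scale. Qed.
HB.instance Definition _ := GRing.isLinear.Build k V (vquot A) *:%R vpi vpi_linear.
End Scale.
End Quotients.
Arguments vpi {k V} A x.

Section BandMatrices.
Variable (k : fieldType).

Definition banded (S : lmodType k) : {pred (int -> int -> S)} :=
  fun phi => `[< exists K : nat, forall i j : int,
                   (K < `|i - j|)%N -> phi i j = 0 >].

Lemma banded_submod_closed S : submod_closed (@banded S).
Proof.
split=> [|a phi psi /asboolP[K hK] /asboolP[L hL]]; apply/asboolP.
  by exists 0.
exists (maxn K L) => i j; rewrite gtn_max => /andP[ltK ltL].
transitivity (a *: phi i j + psi i j); first by [].
by rewrite hK // hL // scaler0 addr0.
Qed.

HB.instance Definition _ (S : lmodType k) :=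
  GRing.isSubmodClosed.Build k (int -> int -> S) (@banded S)
    (banded_submod_closed S).

Record bandmx (S : lmodType k) := BandMx {
  bandmx_val :> int -> int -> S;
  bandmxP : bandmx_val \in @banded S }.

HB.instance Definition _ (S : lmodType k) := [isSub for @bandmx_val S].
HB.instance Definition _ (S : lmodType k) := [Choice of bandmx S by <:].
HB.instance Definition _ (S : lmodType k) := [SubChoice_isSubLmodule of bandmx S by <:].

Lemma bandmx_eqP (S : lmodType k) (phi psi : bandmx S) :
  (forall i j, phi i j = psi i j) -> phi = psi.
Proof. by move=> e; apply/val_inj/funext => i; apply/funext => j; apply: e. Qed.

Lemma bandmx_band (S : lmodType k) (phi : bandmx S) :
  exists K : nat, forall i j : int, (K < `|i - j|)%N -> phi i j = 0.
Proof. by have /asboolP := bandmxP phi. Qed.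

Lemma bandmxDE (S : lmodType k) (phi psi : bandmx S) i j :
  (phi + psi) i j = phi i j + psi i j.
Proof. by []. Qed.
Lemma bandmxZE (S : lmodType k) a (phi : bandmx S) i j :
  (a *: phi) i j = a *: phi i j.
Proof. by []. Qed.

Definition window (i : int) (K : nat) : seq int :=
  [seq i - K%:Z + m%:Z | m <- iota 0 (K + K).+1].

Lemma mem_window i K j : (j \in window i K) = (`|i - j| <= K)%N.
Proof.
apply/mapP/idP => [[m]|le_ijK]; first by rewrite mem_iota => h ->; lia.
by exists (absz (j - i + K%:Z)); rewrite ?mem_iota; lia.
Qed.

Lemma fsbig_window (S : zmodType) (F : int -> S) i K :
  (forall j, (K < `|i - j|)%N -> F j = 0) ->
  \sum_(j \in setT) F j = \sum_(j <- window i K) F j.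
Proof.
move=> F0; have uw : uniq (window i K).
  by rewrite map_inj_uniq ?iota_uniq// => m m'; lia.
rewrite (fsbigE (window i K))//; last first.
  by move=> j _; rewrite mem_window -ltnNge => /F0.
by apply: eq_bigl => j; rewrite in_setT.
Qed.

Section Ring.
Variable S : algType k.
Implicit Types phi psi : bandmx S.

Definition bmul_fun phi psi : int -> int -> S :=
  fun i j => \sum_(l \in setT) phi i l * psi l j.

Lemma bmul_window phi psi i j K :
  (forall l, (K < `|i - l|)%N -> phi i l = 0) ->
  bmul_fun phi psi i j = \sum_(l <- window i K) phi i l * psi l j.
Proof. by move=> h; apply: fsbig_window => l /h ->; rewrite mul0r. Qed.

Lemma bmul_banded phi psi : bmul_fun phi psi \in @banded S.
Proof.
have [[K hK] [L hL]] := (bandmx_band phi, bandmx_band psi).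
apply/asboolP; exists (K + L)%N => i j ltKL.
rewrite (bmul_window _ _ (hK i)) big_seq big1// => l; rewrite mem_window => leK.
by rewrite hL ?mulr0//; lia.
Qed.

Definition bmul phi psi := BandMx (bmul_banded phi psi).

Lemma bscal_banded (c : bandmx k^o) :
  (fun i j => (c i j : k) *: (1 : S)) \in @banded S.
Proof.
have [K hK] := bandmx_band c.
by apply/asboolP; exists K => i j /hK ->; rewrite scale0r.
Qed.
Definition bscal c := BandMx (bscal_banded c).

Lemma bdiag_banded (x : S) :
  (fun i j : int => if i == j then x else 0) \in @banded S.
Proof. by apply/asboolP; exists 0%N => i j; case: eqP => // ->; lia. Qed.
Definition bdiag x := BandMx (bdiag_banded x).

Lemma bmulE phi psi i j K :
  (forall l, (K < `|i - l|)%N -> phi i l = 0) ->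
  bmul phi psi i j = \sum_(l <- window i K) phi i l * psi l j.
Proof. exact: bmul_window. Qed.

Lemma sum_window1 i K (F : int -> S) :
  (forall l, l != i -> F l = 0) -> \sum_(l <- window i K) F l = F i.
Proof.
move=> F0; rewrite -(@fsbig_window _ F i K); last first.
  by move=> j h; apply: F0; apply: contraTneq h => ->; rewrite subrr.
rewrite (@fsbig_window _ F i 0); last first.
  by move=> j h; apply: F0; apply: contraTneq h => ->; rewrite subrr.
by rewrite /window /= big_seq1 subr0 addr0.
Qed.

Lemma bmulA : associative bmul.
Proof.
move=> phi psi chi; have [K hK] := bandmx_band phi.
have [L hL] := bandmx_band psi; have [M hM] := bandmx_band (bmul phi psi).
pose N := (K + L + M)%N; apply: bandmx_eqP => i j.
rewrite (@bmulE _ _ _ _ N); last by move=> l h; apply: hK; lia.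
rewrite [RHS](@bmulE _ _ _ _ N); last by move=> l h; apply: hM; lia.
transitivity (\sum_(l <- window i N) \sum_(m <- window i N)
                 phi i l * (psi l m * chi m j)).
  apply: eq_big_seq => l _; have [leK|/hK ->] := leqP `|i - l| K; last first.
    by rewrite mul0r big1// => m _; rewrite mul0r.
  rewrite -mulr_sumr /= /bmul_fun; congr (_ * _).
  by apply: fsbig_window => m h; rewrite hL ?mul0r//; lia.
rewrite exchange_big; apply: eq_bigr => m _.
rewrite (@bmulE _ _ _ _ N); last by move=> l h; apply: hK; lia.
by rewrite mulr_suml; apply: eq_bigr => l _; rewrite mulrA.
Qed.

Lemma bmul1l : left_id (bdiag 1) bmul.
Proof.
move=> phi; apply: bandmx_eqP => i j.
rewrite (@bmulE _ _ _ _ 0); last by move=> l h /=; case: eqP => //; lia.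
by rewrite sum_window1 /= ?eqxx ?mul1r// => l h; rewrite eq_sym (negPf h) mul0r.
Qed.

Lemma bmul1r : right_id (bdiag 1) bmul.
Proof.
move=> phi; apply: bandmx_eqP => i j /=; rewrite /bmul_fun.
rewrite (@fsbig_window _ _ j 0); last first.
  by move=> l h /=; case: eqP => [|_]; rewrite ?mulr0//; lia.
by rewrite sum_window1 /= ?eqxx ?mulr1// => l h; rewrite (negPf h) mulr0.
Qed.

Lemma bmulDl : left_distributive bmul +%R.
Proof.
move=> phi psi chi; have [K hK] := bandmx_band phi.
have [L hL] := bandmx_band psi; apply: bandmx_eqP => i j; rewrite bandmxDE.
rewrite !(@bmulE _ _ _ _ (K + L)%N); last first.
- by move=> l h; rewrite bandmxDE hK ?hL ?addr0//; lia.
- by move=> l h; apply: hK; lia.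
- by move=> l h; apply: hL; lia.
by rewrite -big_split; apply: eq_bigr => l _; rewrite bandmxDE mulrDl.
Qed.

Lemma bmulDr : right_distributive bmul +%R.
Proof.
move=> phi psi chi; have [K hK] := bandmx_band phi.
apply: bandmx_eqP => i j; rewrite bandmxDE !(bmulE _ _ (hK i)).
by rewrite -big_split; apply: eq_bigr => l _; rewrite bandmxDE mulrDr.
Qed.

Lemma bone_neq0 : bdiag 1 != 0.
Proof.
apply/eqP => /(congr1 (fun phi : bandmx S => phi 0 0)) /=.
by apply/eqP; exact: oner_neq0.
Qed.

HB.instance Definition _ :=
  GRing.Zmodule_isNzRing.Build (bandmx S)
    bmulA bmul1l bmul1r bmulDl bmulDr bone_neq0.

Lemma bscaleAl a phi psi : a *: (phi * psi) = (a *: phi) * psi.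
Proof.
have [K hK] := bandmx_band phi; apply: bandmx_eqP => i j.
rewrite bandmxZE (bmulE _ _ (hK i)).
rewrite [RHS](@bmulE _ _ _ _ K); last first.
  by move=> l h; rewrite bandmxZE hK ?scaler0.
by rewrite scaler_sumr; apply: eq_bigr => l _; rewrite bandmxZE scalerAl.
Qed.

Lemma bscaleAr a phi psi : a *: (phi * psi) = phi * (a *: psi).
Proof.
have [K hK] := bandmx_band phi; apply: bandmx_eqP => i j.
rewrite bandmxZE !(bmulE _ _ (hK i)).
by rewrite scaler_sumr; apply: eq_bigr => l _; rewrite bandmxZE scalerAr.
Qed.

HB.instance Definition _ := GRing.Lmodule_isLalgebra.Build k (bandmx S) bscaleAl.
HB.instance Definition _ := GRing.Lalgebra_isAlgebra.Build k (bandmx S) bscaleAr.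
End Ring.
End BandMatrices.

Section FreegLift.
Variables (R : nzRingType) (M : lmodType R) (K : choiceType) (f : K -> M).

Lemma fglift_scalable : scalable (fglift f).
Proof.
have fB u v : fglift f (u - v) = fglift f u - fglift f v.
  exact: lift_is_additive.
have f0 : fglift f 0 = 0 by rewrite -(subrr 0) fB subrr.
have fD u v : fglift f (u + v) = fglift f u + fglift f v.
  by rewrite -[v in LHS]opprK fB -[- v]sub0r fB f0 sub0r opprK.
have fs (s : seq K) (g : K -> R) :
    fglift f (\sum_(x <- s) << g x *g x >>) = \sum_(x <- s) g x *: f x.
  elim: s => [|x s IH]; last by rewrite !big_cons fD IH liftU.
  by rewrite !big_nil f0.
move=> a D; rewrite -[D in RHS]freeg_sumE -[a *: D]/(fgscale a D) /fgscale !fs.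
by rewrite scaler_sumr; apply: eq_bigr => x _; rewrite scalerA.
Qed.

HB.instance Definition _ :=
  GRing.isZmodMorphism.Build {freeg K / R} M (fglift f) (lift_is_additive f).
HB.instance Definition _ :=
  GRing.isScalable.Build R {freeg K / R} M *:%R (fglift f) fglift_scalable.
End FreegLift.

Section Exterior.
Variables (k : fieldType) (V : lmodType k).
Local Notation F := {freeg (seq V) / k}.

Definition ext_rel : set F :=
  [set z | exists l r a (x y : V), z =
     << l ++ (a *: x + y) :: r >> - a *: << l ++ x :: r >> - << l ++ y :: r >>]
  `|` [set z | exists l r (x : V), z = << l ++ x :: x :: r >>].

(* The exterior algebra of V, as the quotient of the free module on finite
   sequences of vectors by multilinearity and x /\ x = 0. *)
Definition ext : lmodType k := vquot ext_rel.
Definition wedge (l : seq V) : ext := vpi ext_rel << l >>.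

(* The linear map wedge l |-> f l, for f multilinear and alternating. *)
Definition ext_lift (W : lmodType k) (f : seq V -> W) (z : ext) : W :=
  fglift f (repr z).

Definition ext_compat (W : lmodType k) (f : seq V -> W) : Prop :=
  (forall l r a x y, f (l ++ (a *: x + y) :: r) =
     a *: f (l ++ x :: r) + f (l ++ y :: r)) /\
  (forall l r x, f (l ++ x :: x :: r) = 0).

Lemma fglift_span (W : lmodType k) (f : seq V -> W) (z : F) :
  ext_compat f -> span ext_rel z -> fglift f z = 0.
Proof.
move=> [flin falt]; elim=> [|a u v Ru _ IH]; first by rewrite raddf0.
suff fu : fglift f u = 0 by rewrite linearP /= fu IH scaler0 addr0.
case: Ru => [[l [r [b [x [y ->]]]]]|[l [r [x ->]]]].
  rewrite [LHS]raddfB /= [X in X - _]raddfB /= linearZ /= !liftU !scale1r flin.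
  by rewrite [X in X - _]addrAC subrr add0r subrr.
by rewrite liftU scale1r falt.
Qed.

Lemma ext_liftE (W : lmodType k) (f : seq V -> W) (z : F) :
  ext_compat f -> ext_lift f (vpi ext_rel z) = fglift f z.
Proof.
move=> cf; apply/eqP; rewrite -subr_eq0 -raddfB /=; apply/eqP/fglift_span => //.
by apply/asboolP/vpi_eqP; rewrite vpi_repr.
Qed.

Lemma ext_lift_wedge (W : lmodType k) (f : seq V -> W) l :
  ext_compat f -> ext_lift f (wedge l) = f l.
Proof. by move=> cf; rewrite ext_liftE // liftU scale1r. Qed.

Lemma ext_liftP (W : lmodType k) (f : seq V -> W) a u v :
  ext_compat f ->
  ext_lift f (a *: u + v) = a *: ext_lift f u + ext_lift f v.
Proof.
move=> cf; rewrite -[u]vpi_repr -[v]vpi_repr -linearP.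
by rewrite !ext_liftE // linearP.
Qed.

Lemma wedge_compat : ext_compat wedge.
Proof.
split=> [l r a x y|l r x]; last first.
  rewrite -[RHS](raddf0 (vpi ext_rel)).
  apply/vpi_eqP/asboolP; rewrite subr0 -[X in span _ X]addr0 -[X in X + _]scale1r.
  by apply: spanD; [right; exists l, r, x | exact: span0].
rewrite /wedge -linearP; apply/vpi_eqP/asboolP.
rewrite opprD addrA -[X in span _ X]addr0 -[X in X + _]scale1r.
by apply: spanD; [left; exists l, r, a, x, y | exact: span0].
Qed.

Lemma wedgeP l r a x y : wedge (l ++ (a *: x + y) :: r) =
  a *: wedge (l ++ x :: r) + wedge (l ++ y :: r).
Proof. exact: wedge_compat.1. Qed.

Lemma wedge_alt l r x : wedge (l ++ x :: x :: r) = 0.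
Proof. exact: wedge_compat.2. Qed.

Lemma wedge_ind (P : ext -> Prop) :
  P 0 -> (forall a l u, P u -> P (a *: wedge l + u)) -> forall u, P u.
Proof.
move=> P0 PD u; rewrite -[u]vpi_repr -[repr u]freeg_sumE.
elim: (dom _) => [|l s IH]; first by rewrite big_nil raddf0.
rewrite big_cons raddfD /=; set c := coeff _ _.
suff -> : << c *g l >> = c *: << l >> by rewrite linearZ; apply: PD.
by apply/eqP/freeg_eqP => m; rewrite coeffZ !coeffU mul1r.
Qed.

Definition ext_cons (x : V) : ext -> ext := ext_lift (fun l => wedge (x :: l)).

Lemma cons_compat x : ext_compat (fun l => wedge (x :: l)).
Proof. by split=> *; rewrite -!cat_cons ?wedgeP ?wedge_alt. Qed.

Lemma ext_consE x l : ext_cons x (wedge l) = wedge (x :: l).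
Proof. exact/ext_lift_wedge/cons_compat. Qed.

Lemma ext_consP x a u v :
  ext_cons x (a *: u + v) = a *: ext_cons x u + ext_cons x v.
Proof. exact/ext_liftP/cons_compat. Qed.

HB.instance Definition _ x :=
  GRing.isLinear.Build k ext ext *:%R (ext_cons x) (fun a u v => ext_consP x a u v).

Lemma ext_consDl a x y u :
  ext_cons (a *: x + y) u = a *: ext_cons x u + ext_cons y u.
Proof.
elim/wedge_ind: u => [|b l u IH]; first by rewrite !linear0 ?scaler0 addr0.
rewrite !ext_consP !ext_consE IH (wedgeP [::]) !scalerDr !scalerA.
by rewrite [a * b]mulrC addrACA.
Qed.

Lemma ext_consxx x u : ext_cons x (ext_cons x u) = 0.
Proof.
elim/wedge_ind: u => [|b l u IH]; first by rewrite !linear0.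
by rewrite !ext_consP !ext_consE IH (wedge_alt [::]) scaler0 addr0.
Qed.

Lemma ext_consC x y u : ext_cons x (ext_cons y u) = - ext_cons y (ext_cons x u).
Proof.
apply/eqP; rewrite -addr_eq0; have := ext_consxx (1 *: x + y) u.
rewrite !ext_consDl !scale1r !raddfD /= !ext_consxx add0r addr0 => /eqP.
by [].
Qed.
End Exterior.

Section ChevalleyEilenberg.
Variables (k : fieldType) (A : algType k).

Definition lbr (f g : A) : A := f * g - g * f.

Definition del (i : nat) (l : seq A) := take i l ++ drop i.+1 l.

Definition ce_diff_seq (l : seq A) : ext A :=
  \sum_(j < size l) \sum_(i < j)
    (-1) ^+ (i + j) *: wedge (lbr l`_i l`_j :: del i (del j l)).

Definition ce_diff : ext A -> ext A := ext_lift ce_diff_seq.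

(* The adjoint action of x on wedge l. *)
Fixpoint ce_ad (x : A) (l : seq A) : ext A :=
  if l is y :: l' then wedge (lbr x y :: l') + ext_cons y (ce_ad x l') else 0.

Fixpoint ce_rec (l : seq A) : ext A :=
  if l is x :: l' then - ext_cons x (ce_rec l') - ce_ad x l' else 0.

Lemma lbrDr x a y z : lbr x (a *: y + z) = a *: lbr x y + lbr x z.
Proof.
by rewrite /lbr mulrDr mulrDl scalerBr -scalerAr -scalerAl opprD addrACA.
Qed.

Lemma lbrDl x a y z : lbr (a *: y + z) x = a *: lbr y x + lbr z x.
Proof.
by rewrite /lbr mulrDr mulrDl scalerBr -scalerAr -scalerAl opprD addrACA.
Qed.

Lemma lbrxx x : lbr x x = 0. Proof. exact: subrr. Qed.

Lemma wedge0 (l : seq A) : wedge (0 :: l) = 0.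
Proof.
have := wedgeP [::] l (-1) 0 (0 : A).
by rewrite scaler0 addr0 scaleN1r addNr.
Qed.

Lemma ce_ad_compat x : ext_compat (ce_ad x).
Proof.
split=> [l r a y z|l r y]; elim: l => [|t l IH] /=.
- by rewrite lbrDr (wedgeP [::]) ext_consDl scalerDr addrACA.
- by rewrite IH ext_consP -!cat_cons wedgeP scalerDr addrACA.
- by rewrite raddfD /= ext_consE ext_consxx addr0 -!ext_consE ext_consC addNr.
by rewrite IH raddf0 addr0 -cat_cons wedge_alt.
Qed.

Lemma ce_ad_lin a x y l : ce_ad (a *: x + y) l = a *: ce_ad x l + ce_ad y l.
Proof.
elim: l => [|z l IH] /=; first by rewrite scaler0 addr0.
by rewrite lbrDl (wedgeP [::]) IH ext_consP scalerDr addrACA.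
Qed.

Lemma ce_rec_compat : ext_compat ce_rec.
Proof.
split=> [l r a y z|l r y]; elim: l => [|t l IH] /=.
- by rewrite ext_consDl ce_ad_lin scalerBr scalerN !opprD addrACA.
- rewrite IH ext_consP (ce_ad_compat t).1 scalerBr scalerN !opprD.
  by rewrite addrACA.
- rewrite raddfB raddfN /= ext_consxx oppr0 sub0r opprK lbrxx wedge0 add0r.
  by rewrite subrr.
by rewrite IH raddf0 oppr0 (ce_ad_compat t).2 subr0.
Qed.

Lemma ce_adE x l :
  ce_ad x l = \sum_(j < size l) (-1) ^+ j *: wedge (lbr x l`_j :: del j l).
Proof.
elim: l => [|y l IH] /=; first by rewrite big_ord0.
rewrite big_ord_recl /= expr0 scale1r /del /= drop0; congr (_ + _).
rewrite IH raddf_sum /=; apply: eq_bigr => j _; rewrite linearZ /=.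
rewrite add0n exprS mulN1r scaleNr -scalerN; congr (_ *: _).
by rewrite -!ext_consE ext_consC.
Qed.

Lemma ce_recE l : ce_rec l = ce_diff_seq l.
Proof.
elim: l => [|x l IH] /=; first by rewrite /ce_diff_seq big_ord0.
rewrite /ce_diff_seq /= big_ord_recl big_ord0 add0r IH ce_adE.
under [RHS]eq_bigr do rewrite big_ord_recl.
rewrite big_split /= addrC; congr (_ + _); last first.
  rewrite -sumrN; apply: eq_bigr => j _.
  by rewrite /bump leq0n add0n add1n exprS mulN1r scaleNr /del /= drop0.
rewrite /ce_diff_seq raddf_sum -sumrN; apply: eq_bigr => j _.
rewrite /= raddf_sum -sumrN; apply: eq_bigr => i _.
rewrite /= linearZ /= /bump !leq0n !add1n addSn addnS !exprS !mulN1r opprK.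
by rewrite -scalerN; congr (_ *: _); rewrite -!ext_consE ext_consC opprK.
Qed.

Lemma ce_diff_wedge (l : seq A) : ce_diff (wedge l) =
  \sum_(j < size l) \sum_(i < j)
    (-1) ^+ (i + j) *: wedge (lbr l`_i l`_j :: del i (del j l)).
Proof.
have e : ce_diff_seq = ce_rec by apply/funext => m; rewrite ce_recE.
by rewrite -/(ce_diff_seq l) /ce_diff e ext_lift_wedge//; exact: ce_rec_compat.
Qed.

Definition CE (J : set A) (r : nat) : set (ext A) :=
  if r is r'.+1
  then span [set z | exists2 x, J x & exists2 l, size l = r' & z = wedge (x :: l)]
  else span [set wedge [::]].

(* The identification of the first exterior power of A with A. *)
Definition ext1 : ext A -> A := ext_lift (fun l => if l is [:: x] then x else 0).
End ChevalleyEilenberg.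

(* The data of a first quadrant bicomplex with differentials bc_h of bidegree
   (-1, 0) and bc_v of bidegree (0, -1), commuting without sign.  The term in
   bidegree (p, q) is the subspace bc_part p q of bc_col p; only the restrictions
   of the differentials to these subspaces matter.  The complex axioms are not
   part of the record. *)
Record bicomplex (k : fieldType) := Bicomplex {
  bc_col : nat -> lmodType k;
  bc_part : forall p, nat -> set (bc_col p);
  bc_h : forall p, bc_col p.+1 -> bc_col p;
  bc_v : forall p, bc_col p -> bc_col p }.

Arguments bc_part {k} b p q.

Section SpectralSequence.
Variables (k : fieldType) (C : bicomplex k).

(* th a, .., th b have total degree N, and the horizontal differential of each
   is the vertical differential of the next; terms of negative vertical degree
   are 0. *)
Definition zigzag (a b N : nat) (th : forall p, bc_col C p) : Prop :=
  (forall p, (b <= p <= a)%N ->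
     if (p <= N)%N then bc_part C p (N - p) (th p) else th p = 0) /\
  (forall p, (b <= p < a)%N -> bc_h (th p.+1) = bc_v (th p)).

(* E^r_(p,q) = Z^r_(p,q) / B^r_(p,q) (r >= 1) in the spectral sequence of the
   filtration by columns.  Columns of negative index are 0, which is why the
   truncated subtraction is the right lower bound. *)
Definition ss_Z (r p q : nat) : set (bc_col C p) :=
  [set x | [/\ bc_part C p q x, bc_v x = 0 &
     exists th, th p = x /\ zigzag p (p.+1 - r) (p + q) th]].

Arguments ss_Z : clear implicits.

Definition ss_B (r p q : nat) : set (bc_col C p) :=
  [set x | exists y th, [/\ bc_part C p q.+1 y,
     zigzag (p + r) p.+1 (p + q).+1 th, th (p + r)%N = 0 &
     x = bc_v y + bc_h (th p.+1)]].

Arguments ss_B : clear implicits.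

(* E^r_(p,q) is the subspace ss_page r p q of ss_quot r p q. *)
Definition ss_quot (r p q : nat) : lmodType k := vquot (ss_B r p q).
Definition ss_pi (r p q : nat) (x : bc_col C p) : ss_quot r p q :=
  vpi (ss_B r p q) x.
Arguments ss_pi : clear implicits.

Definition ss_page (r p q : nat) : set (ss_quot r p q) :=
  [set ss_pi r p q x | x in ss_Z r p q].

Arguments ss_page : clear implicits.

(* The differential E^r_(p+r,q) -> E^r_(p,q+r-1): [th_(p+r)] is sent to
   [bc_h th_(p+1)] for any zigzag starting from a vertical cycle. *)
Definition ss_d (r p q : nat) (e : ss_quot r (p + r) q) :
    ss_quot r p (q + r).-1 :=
  xget 0 [set e' | exists th : forall p, bc_col C p,
    [/\ zigzag (p + r) p.+1 (p + r + q) th, bc_v (th (p + r)%N) = 0,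
        e = ss_pi r (p + r) q (th (p + r)%N) &
        e' = ss_pi r p (q + r).-1 (bc_h (th p.+1))]].

Arguments ss_d : clear implicits.

(* The map of subquotients induced by the identity of the term (p, q); for
   p = 0 and r <= r' it is the edge projection, and for the last column p and
   r' <= r the edge inclusion. *)
Definition ss_edge (r r' p q : nat) (e : ss_quot r p q) : ss_quot r' p q :=
  ss_pi r' p q (repr e).
Arguments ss_edge : clear implicits.
End SpectralSequence.
Arguments ss_pi {k} C r p q x.
Arguments ss_page {k} C r p q _.
Arguments ss_d {k} C r p q e.
Arguments ss_edge {k} C r r' p q e.

Section BeilinsonBicomplex.
Variable (k : fieldType).

Fixpoint Emx (n : nat) : algType k :=
  if n is n'.+1 then bandmx (Emx n') : algType k else k^o.

(* E^n(k) is iterated from the inside, so that the outermost matrix indices of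
   Emx n.+1 belong to the place of index n; places are counted from 0.  place n i
   embeds E(k) in the place of index i < n. *)
Fixpoint place (n i : nat) (c : bandmx k^o) : Emx n :=
  match n return Emx n with
  | 0 => 0
  | n'.+1 => if i == n' then bscal (Emx n') c else bdiag (place n' i c)
  end.

(* The ideals I^+ (e = true) and I^- (e = false) in the place of index i. *)
Fixpoint ideal (n i : nat) (e : bool) : set (Emx n) :=
  match n return set (Emx n) with
  | 0 => setT
  | n'.+1 => if i == n'
    then [set phi | exists B : int, forall a b : int,
                      (if e then a < B else B < b) -> phi a b = 0]
    else [set phi | forall a b : int, ideal i e (phi a b)]
  end.

Definition Itr (n : nat) : set (Emx n) :=
  [set phi | forall i : 'I_n, ideal i true phi /\ ideal i false phi].

Fixpoint tr (n : nat) : Emx n -> k :=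
  match n return Emx n -> k with
  | 0 => fun x => x
  | n'.+1 => fun phi => tr (\sum_(i \in setT) phi i i)
  end.

(* k[t_1^(+-1), .., t_n^(+-1)], as combinations of exponent vectors; its product
   enters only through the embedding mulop into Emx n. *)
Definition laurent (n : nat) : lmodType k := {freeg {ffun 'I_n -> int} / k}.

Lemma shift_banded (m : int) :
  (fun i j : int => (i == j + m)%:R : k^o) \in @banded k k^o.
Proof. by apply/asboolP; exists (absz m) => i j; case: eqP => // ->; lia. Qed.
Definition shift m := BandMx (shift_banded m).

Lemma cut_banded :
  (fun i j : int => ((i == j) && (0 <= i))%:R : k^o) \in @banded k k^o.
Proof. by apply/asboolP; exists 0%N => i j; case: eqP => // ->; lia. Qed.
Definition cut := BandMx cut_banded.

Variable n : nat.

(* In the monomial basis, multiplication by t_(i+1)^m is the matrix shift m in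
   the place of index i. *)
Definition mulop (f : laurent n) : Emx n :=
  fglift (fun lam : {ffun 'I_n -> int} =>
            \prod_(i < n) place n i (shift (lam i))) f.

Definition proj (j : nat) (e : bool) : Emx n :=
  if e then place n j cut else 1 - place n j cut.

Definition sg (e : bool) : k := if e then 1 else -1.

Definition residue (f : 'I_n.+1 -> laurent n) : k :=
  (-1) ^+ n * tr (\sum_(pi : 'S_n) (-1) ^+ pi *:
    \sum_(gam : {ffun 'I_n -> bool}) (\prod_i sg (gam i)) *:
      foldr (fun (i : 'I_n) (g : Emx n) =>
               proj i (~~ gam i) *
                 lbr (mulop (f (fintype.lift ord0 (pi i)))) (proj i (gam i) * g))
            (mulop (f ord0)) (enum 'I_n)).

(* Multi-signs: Some true is +, Some false is -, None is 0. *)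
Local Notation sgn := {ffun 'I_n -> option bool}.
Local Notation ExtA := (ext (Emx n)).

Definition sdeg (s : sgn) : nat := #|[pred i | s i == None]|.+1.

Definition Xpart (i : 'I_n) (u : option bool) (q : nat) : set ExtA :=
  if u is Some e then CE (ideal i e) q
  else CE (ideal i true) q `&` CE (ideal i false) q.

Definition Tcol (p : nat) : lmodType k :=
  if p is 0 then ExtA else {ffun sgn -> ExtA}.

Definition Tpart (p q : nat) : set (Tcol p) :=
  match p return set (Tcol p) with
  | 0 => CE setT q
  | p'.+1 => [set f : {ffun sgn -> ExtA} | forall s,
      if sdeg s == p'.+1 then forall i, Xpart i (s i) q (f s) else f s = 0]
  end.

Definition Th (p : nat) : Tcol p.+1 -> Tcol p :=
  match p return Tcol p.+1 -> Tcol p with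
  | 0 => fun f : {ffun sgn -> ExtA} =>
      \sum_(e : {ffun 'I_n -> bool})
        (\prod_i sg (e i)) *: f [ffun i => Some (e i)]
  | p'.+1 => fun f : {ffun sgn -> ExtA} => [ffun s : sgn =>
      \sum_(i | s i != None)
        (-1) ^+ #|[pred j : 'I_n | (i < j)%N && (s j == None)]| *:
          f [ffun j => if j == i then None else s j]]
  end.

Definition Tv (p : nat) : Tcol p -> Tcol p :=
  match p return Tcol p -> Tcol p with
  | 0 => @ce_diff k (Emx n)
  | p'.+1 => fun f : {ffun sgn -> ExtA} => [ffun s => ce_diff (f s)]
  end.

Definition Tbc : bicomplex k := Bicomplex Tpart Th Tv.

(* H_0(G, I_tr) = I_tr / [I_tr, G], the image of I_tr in H0tr. *)
Definition comm_Itr : set (Emx n) :=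
  [set z | exists x g, Itr x /\ z = lbr x g].

Definition H0tr : lmodType k := vquot comm_Itr.
Definition trH0 (u : H0tr) : k := tr (repr u).

(* The identification of E^1_(n+1,1) with I_tr / [I_tr, G]: the only multi-sign
   of degree n+1 is constantly 0. *)
Definition toH0 (e : ss_quot Tbc 1 n.+1 1) : H0tr :=
  vpi comm_Itr (ext1 ((repr e : {ffun sgn -> ExtA}) [ffun=> None])).

Definition kappa (f : 'I_n.+1 -> laurent n) : ss_quot Tbc 1 0 n.+1 :=
  ss_pi Tbc 1 0 n.+1 (wedge [seq mulop (f i) | i <- enum 'I_n.+1]).

Definition rho2 : ss_quot Tbc 1 0 n.+1 -> ss_quot Tbc n.+1 0 n.+1 :=
  ss_edge Tbc 1 n.+1 0 n.+1.
Definition rho1 (e : ss_quot Tbc n.+1 n.+1 1) : H0tr :=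
  toH0 (ss_edge Tbc n.+1 1 n.+1 1 e).
Definition dlast : ss_quot Tbc n.+1 n.+1 1 -> ss_quot Tbc n.+1 0 n.+1 :=
  ss_d Tbc n.+1 0 1.
Definition dlast_inv : ss_quot Tbc n.+1 0 n.+1 -> ss_quot Tbc n.+1 n.+1 1 :=
  'pinv_(fun=> 0) (ss_page Tbc n.+1 n.+1 1) dlast.

End BeilinsonBicomplex.

(* Main.v *)
From HB Require Import structures.
From mathcomp Require Import all_boot all_order all_fingroup all_algebra.
From mathcomp Require Import boolp classical_sets functions.
From mathcomp Require Import fsbigop zify generic_quotient.
From mathcomp.multinomials Require Import freeg.
Require Import Defs.

Set Implicit Arguments.
Unset Strict Implicit.
Unset Printing Implicit Defensive.
Import Order.TTheory GRing.Theory.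

Local Open Scope classical_set_scope.
Local Open Scope ring_scope.

(** The last differential.  The rows of the bicomplex are exact.  Left
    multiplication by 1 - P_i, applied to all factors of a wedge, maps the
    Chevalley-Eilenberg complex of the whole algebra into the subcomplex of I_i^-,
    and the identity minus this map has its values in the subcomplex of I_i^+; both
    maps preserve the subcomplexes of all the ideals.  This splits the row in the
    place i (row_homotopy), and doing so in every place contracts it.  A bicomplex
    with exact rows in columns 0, .., n+1 whose vertical differential vanishes in
    vertical degree 1 has a bijective last differential: zigzags that start at a
    cycle of column 0 exist, and a zigzag that starts at a boundary ends at a
    boundary (ss_d_last_bij).  Hence the composition of the edge maps with the inverse
    of the differential sends the class of a cycle of column 0 to the class of the
    last term of any zigzag that starts at it.

    The trace.  The last column consists of intersections of the subcomplexes of the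
    2n ideals I_i^+, I_i^-, and such an intersection is larger than the subcomplex of
    the intersection I_tr of the ideals: x /\ y with x in I_i^+ and y in I_i^- lies
    in the subcomplexes of both.  So a vertical boundary in the last column does not
    come as a combination of commutators of I_tr with the whole algebra.  It is,
    however, a sum of commutators [x, g] such that each of the ideals contains x or
    g (CE_balanced), and for these the usual proof of tr (x g) = tr (g x) works, as
    the double sums are finite (tr_lbr).  Hence the trace of the last term of a
    zigzag depends on its class only.

    The zigzag of a symbol.  Think of sums of a /\ f_j1 /\ f_j2 /\ .. as elements of
    the tensor product of the matrix algebra with an exterior algebra.  As the f_j
    commute, the Chevalley-Eilenberg differential acts there as the odd operator
    D = sum_j ad(f_j) c_j, where c_j contracts with f_j, and D D = 0.  Every sign e
    satisfies D (e P^e) = [D, P] + (e P^e) D with P = P^+, while D [D, P] =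
    - [D, P] D.  For a multi-sign s take the product over the places i of the
    operators e P_i^e if s_i = e is a sign, and [D, P_i] if s_i = 0, and apply it to
    f_0 /\ .. /\ f_n (cut_chain).  By the two identities and D f_0 = 0, applying D to
    the result gives, up to sign, the alternating sum of what is obtained by replacing
    one sign in s by 0: this is the equation of a zigzag (ce_diff_cut_chain).
    The sum over all s in {+,-}^n is f_0 /\ .. /\ f_n since P_i^+ + P_i^- = 1
    (sum_cut_chain).  For s = 0 all the f_j with j > 0 are contracted, in all the
    orders, and [ad f, P] = sum_e e P^(-e) (ad f) P^e turns the result into the
    residue formula (residueE).  The signs collected on the way multiply to
    (-1)^(n (n+1)) = 1. *)

(** * Spans and quotients *)

Section Spans.
Variables (k : fieldType) (V : lmodType k).
Implicit Types (A B : set V).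

Lemma span_mem A x : A x -> span A x.
Proof. by move=> Ax; rewrite -[x]addr0 -[x]scale1r; apply: spanD => //; apply: span0. Qed.

Lemma spanN A x : span A x -> span A (- x).
Proof. by rewrite -scaleN1r; apply: span_scale. Qed.

Lemma span_add A x y : span A x -> span A y -> span A (x + y).
Proof. by move=> Ax Ay; rewrite -[y]opprK; apply/span_sub/spanN. Qed.

Definition subspace A :=
  A 0 /\ forall a x y, A x -> A y -> A (a *: x + y).

Lemma span_subspace A : subspace (span A).
Proof. by split=> [|a x y Ax Ay]; [exact: span0 | apply/span_add/Ay/span_scale]. Qed.

Lemma span_min A B : subspace B -> A `<=` B -> span A `<=` B.
Proof.
by move=> [B0 Blin] AB x; elim=> // a y z Ay _ Bz; apply: Blin => //; apply: AB.
Qed.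

Section Subspace.
Variables (A : set V) (sA : subspace A).

Lemma subspace0 : A 0. Proof. exact: sA.1. Qed.

Lemma subspaceZ a x : A x -> A (a *: x).
Proof. by move=> Ax; rewrite -[_ *: _]addr0; apply: sA.2 => //; apply: subspace0. Qed.

Lemma subspaceD x y : A x -> A y -> A (x + y).
Proof. by move=> Ax Ay; rewrite -[x]scale1r; apply: sA.2. Qed.

Lemma subspaceN x : A x -> A (- x).
Proof. by move=> Ax; rewrite -scaleN1r; apply: subspaceZ. Qed.

Lemma subspaceB x y : A x -> A y -> A (x - y).
Proof. by move=> Ax Ay; apply/subspaceD/subspaceN. Qed.

Lemma subspace_sum (I : Type) (r : seq I) (P : pred I) (F : I -> V) :
  (forall i, P i -> A (F i)) -> A (\sum_(i <- r | P i) F i).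
Proof. by move=> AF; elim/big_ind: _ => //; [apply: subspace0 | apply: subspaceD]. Qed.

End Subspace.

Lemma vpi_eq A x y : vpi A x = vpi A y <-> span A (x - y).
Proof.
split=> [/vpi_eqP /asboolP //|h].
exact/vpi_eqP/asboolP.
Qed.

(** Maps out of a quotient are evaluated on representatives; this is the ambiguity
    that has to be controlled. *)
Lemma repr_vpi A x : exists2 b, span A b & repr (vpi A x) = x + b.
Proof.
exists (repr (vpi A x) - x); last by rewrite addrC subrK.
by apply/vpi_eq; rewrite vpi_repr.
Qed.

End Spans.

(** * The last differential of a bicomplex with exact rows *)

Section LastDifferential.
Variables (k : fieldType) (C : bicomplex k) (n : nat).
Local Notation h := (@bc_h k C _).
Local Notation v := (@bc_v k C _).
Local Notation part := (bc_part C).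

(** By erb_v1, a zigzag that ends in vertical degree 1 ends with a vertical
    cycle. *)
Record exact_rows_bicomplex : Prop := ExactRowsBicomplex {
  erb_sub : forall p q, subspace (part p q);
  erb_hlin : forall p, linear (@bc_h k C p);
  erb_vlin : forall p, linear (@bc_v k C p);
  erb_hpart : forall p q x, part p.+1 q x -> part p q (h x);
  erb_vpart : forall p q x, part p q.+1 x -> part p q (v x);
  erb_v1 : forall p x, part p 1 x -> v x = 0;
  erb_hh : forall p (x : bc_col C p.+2), h (h x) = 0;
  erb_vv : forall p (x : bc_col C p), v (v x) = 0;
  erb_hv : forall p (x : bc_col C p.+1), h (v x) = v (h x);
  erb_surj : forall q x, part 0 q x -> exists2 y, part 1 q y & h y = x;
  erb_exact : forall p q x, part p.+1 q x -> h x = 0 ->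
     exists2 y, part p.+2 q y & h y = x;
  erb_last : forall p q x, (n.+1 < p)%N -> part p q x -> x = 0 }.

Hypothesis E : exact_rows_bicomplex.

Let hB p (x y : bc_col C p.+1) : h (x - y) = h x - h y.
Proof. by rewrite addrC -scaleN1r (erb_hlin E) scaleN1r addrC. Qed.
Let vB p (x y : bc_col C p) : v (x - y) = v x - v y.
Proof. by rewrite addrC -scaleN1r (erb_vlin E) scaleN1r addrC. Qed.
Let h0 p : h 0 = 0 :> bc_col C p.
Proof. by have := hB (0 : bc_col C p.+1) 0; rewrite !subrr. Qed.
Let v0 p : v 0 = 0 :> bc_col C p.
Proof. by have := vB (0 : bc_col C p) 0; rewrite !subrr. Qed.

(* The total degree of the zigzags that define the last differential. *)
Let M := n.+2.

Lemma zigzag_lin b a (c : k) (th th' : forall p, bc_col C p) :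
  zigzag a b M th -> zigzag a b M th' ->
  zigzag a b M (fun p => c *: th p + th' p).
Proof.
move=> [hp he] [hp' he']; split=> p hb.
  have := hp p hb; have := hp' p hb; case: ifP => _ H' H.
    exact: (erb_sub E _ _).2.
  by rewrite H H' scaler0 addr0.
by rewrite (erb_hlin E) (erb_vlin E) he ?he'.
Qed.

(** The vertical differential of the term found last is a row cycle, because the
    vertical differential squares to 0; so a vertical cycle of column 0 can be
    lifted from column to column. *)
Lemma zigzag_lift q x : part 0 q.+1 x -> v x = 0 ->
  forall m, (m <= q)%N ->
  exists th, zigzag m.+1 1 q.+2 th /\ h (th 1%N) = x.
Proof.
move=> Px vx; elim=> [|m IH] lemq.
  have [y Py hy] := erb_surj E Px.
  exists (@dfwith nat (bc_col C) (fun=> 0) 1 y); rewrite dfwith_in; split=> //.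
  split=> p; last by rewrite ltnS => /andP[/leq_trans/[apply]]; rewrite ltnn.
  by rewrite -eqn_leq => /eqP <-; rewrite dfwith_in.
have [th [[hp he] hx]] := IH (ltnW lemq).
have Pm : part m.+1 (q - m) (v (th m.+1)).
  apply: (erb_vpart E); have := hp m.+1; rewrite leqnn /= => /(_ isT).
  by rewrite ltnS (leqW (ltnW lemq)) subSS subSn // ltnW.
have hm : h (v (th m.+1)) = 0.
  rewrite (erb_hv E); case: m lemq th hp he hx {Pm IH} => [|m] lemq th hp he hx.
    by rewrite hx.
  by rewrite he ?leqnn // (erb_vv E).
have [y Py hy] := erb_exact E Pm hm.
exists (@dfwith nat (bc_col C) th m.+2 y); split; last by rewrite dfwith_out.
split=> p.
  rewrite [(p <= m.+2)%N]leq_eqVlt ltnS; have [->|ne] := eqVneq p m.+2.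
    by rewrite dfwith_in !ltnS (ltnW lemq) !subSS => _.
  by move=> /= lp; rewrite dfwith_out 1?eq_sym //; apply: hp.
move=> /andP[p0]; rewrite ltnS leq_eqVlt => /predU1P[[->]|lp].
  by rewrite dfwith_in dfwith_out // gtn_eqF.
by rewrite !dfwith_out; [apply: he; rewrite p0 | rewrite gtn_eqF // ltnW | rewrite gtn_eqF].
Qed.

(** A preimage yy of y along the row corrects the first term of the zigzag: th_1 - v yy
    is a row cycle, and a preimage of it corrects the next term in the same way. *)
Lemma zigzag_descent th y : zigzag n.+1 1 M th -> part 0 M y -> h (th 1%N) = v y ->
  forall p, (p <= n)%N -> exists yy z,
    [/\ part p.+1 (M - p) yy, part p.+2 (M - p.+1) z & h z = th p.+1 - v yy].
Proof.
move=> [hp he] Py hy.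
have Pth p yy : (p <= n)%N -> part p.+1 (M - p) yy ->
    part p.+1 (M - p.+1) (th p.+1 - v yy).
  move=> lep Pyy; apply: (subspaceB (erb_sub E _ _)).
    by have := hp p.+1; rewrite /= !ltnS lep (leqW lep) => /(_ isT).
  by apply: (erb_vpart E); rewrite subSS -subSn // ltnW // ltnW.
elim=> [_|p IH lep].
  have [yy Pyy hyy] := erb_surj E Py.
  have h1 : h (th 1%N - v yy) = 0 by rewrite hB (erb_hv E) hyy hy subrr.
  have [z Pz hz] := erb_exact E (Pth 0 yy isT Pyy) h1.
  by exists yy, z.
have [yy [z [Pyy Pz hz]]] := IH (ltnW lep).
have hth : h (th p.+2) = v (th p.+1) by apply: he; rewrite /= !ltnS.
have h1 : h (th p.+2 - v z) = 0.
  by rewrite hB (erb_hv E) hz vB (erb_vv E) subr0 hth subrr.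
have [z' Pz' hz'] := erb_exact E (Pth p.+1 z lep Pz) h1.
by exists z, z'.
Qed.

(** In the last column the row differential is injective, so that the corrected term
    is 0. *)
Lemma last_boundary th y : zigzag n.+1 1 M th -> part 0 M y -> h (th 1%N) = v y ->
  exists2 yy, part n.+1 2 yy & th n.+1 = v yy.
Proof.
move=> zth Py hy; have [yy [z [Pyy Pz hz]]] := zigzag_descent zth Py hy (leqnn n).
exists yy; first by move: Pyy; rewrite /M -addn2 addKn.
by apply/eqP; rewrite -subr_eq0 -hz (erb_last E _ Pz) ?h0.
Qed.

Lemma zigzag0 a b N : zigzag a b N (fun=> 0 : bc_col C _).
Proof.
split=> p _; last by rewrite h0 v0.
by case: ifP => // _; apply: subspace0 (erb_sub E _ _).
Qed.

Lemma ss_B_vertical r p q y : part p q.+1 y -> @ss_B k C r p q (v y).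
Proof.
by move=> Py; exists y, (fun=> 0); rewrite h0 addr0; split=> //; apply: zigzag0.
Qed.

Lemma span_ss_B0 : span (@ss_B k C n.+1 0 n.+1) `<=` @ss_B k C n.+1 0 n.+1.
Proof.
apply: span_min => //; split.
  have P0 : part 0 n.+2 0 by apply: subspace0 (erb_sub E _ _).
  by have := ss_B_vertical n.+1 P0; rewrite v0.
move=> c _ _ [y [th [Py zth th0 ->]]] [y' [th' [Py' zth' th0' ->]]].
exists (c *: y + y'), (fun p => c *: th p + th' p); split.
- exact: (erb_sub E _ _).2.
- exact: zigzag_lin.
- by rewrite th0 th0' scaler0 addr0.
by rewrite (erb_hlin E) (erb_vlin E) scalerDr addrACA.
Qed.

(** No column lies beyond the last one, so that only vertical boundaries are divided
    out there. *)
Lemma span_ss_B_last r : (0 < r)%N -> span (@ss_B k C r n.+1 1) `<=`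
  [set x | exists2 y, part n.+1 2 y & x = v y].
Proof.
move=> r0; apply: span_min => [|x [y [th [Py [hp _] _ ->]]]].
  split=> [|c _ _ [y Py ->] [y' Py' ->]].
    by exists 0; [apply: subspace0 (erb_sub E _ _) | rewrite v0].
  by exists (c *: y + y'); [exact: (erb_sub E _ _).2 | rewrite (erb_vlin E)].
have ler : (n.+2 <= n.+2 <= n.+1 + r)%N by rewrite leqnn -(addn1 n.+1) leq_add2l.
exists y => //; have := hp n.+2 ler.
by case: ifP => [_ /(erb_last E) ->|_ ->]; rewrite ?h0 ?addr0.
Qed.


Hypothesis n_gt0 : (0 < n)%N.

(** Subtracting h y from the term before the last one makes the last term 0 and
    does not change h th_1. *)
Lemma zigzag_trim th y : zigzag n.+1 1 M th -> part n.+1 2 y -> th n.+1 = v y ->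
  @ss_B k C n.+1 0 n.+1 (h (th 1%N)).
Proof.
move=> [hp he] Py thy.
pose th1 := @dfwith nat (bc_col C) th n (th n - h y).
pose th2 := @dfwith nat (bc_col C) th1 n.+1 0.
have th2n1 : th2 n.+1 = 0 by rewrite /th2 dfwith_in.
have th2n : th2 n = th n - h y.
  by rewrite /th2 dfwith_out ?gtn_eqF // /th1 dfwith_in.
have th2p p : (p < n)%N -> th2 p = th p.
  by move=> lp; rewrite /th2 /th1 !dfwith_out // gtn_eqF // ltnW.
have hth2 p : (p < n)%N -> h (th2 p.+1) = h (th p.+1).
  rewrite leq_eqVlt => /predU1P[|lp]; last by rewrite th2p.
  have: forall m (x : bc_col C m.+1), th2 m = th m - h x ->
      p.+1 = m -> h (th2 p.+1) = h (th p.+1).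
    by move=> m x th2m e; subst m; rewrite th2m hB (erb_hh E) subr0.
  by apply; apply: th2n.
exists 0, th2; split=> //; first exact: subspace0 (erb_sub E _ _).
  split=> p /= /andP[p0].
    rewrite leq_eqVlt => /predU1P[->|].
      by rewrite th2n1; case: ifP => // _; apply: subspace0 (erb_sub E _ _).
    rewrite ltnS leq_eqVlt => /predU1P[->|lp].
      have lenM : (n <= M)%N by rewrite /M leqW // leqW.
      rewrite th2n -[X in (n <= X)%N]/M lenM -[X in part n (X - n)%N]/M.
      apply: (subspaceB (erb_sub E _ _)).
        by have := hp n; rewrite n_gt0 leqnSn lenM => /(_ isT).
      by rewrite /M -addn2 addKn; apply: (erb_hpart E).
    by rewrite th2p //; apply: hp; rewrite p0 ltnW // ltnW.
  rewrite ltnS leq_eqVlt => /predU1P[->|lp].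
    by rewrite th2n1 h0 th2n vB -(erb_hv E) -thy he ?n_gt0 /= // subrr.
  by rewrite hth2 // th2p //; apply: he; rewrite p0 /= ltnS ltnW.
by rewrite v0 add0r; apply/esym/(hth2 0%N).
Qed.

Let zN (th : forall p, bc_col C p) : zigzag n.+1 1 M th -> zigzag n.+1 1 M (fun p => - th p).
Proof.
move=> [hp he]; split=> p hb; last first.
  by rewrite -[- _]sub0r hB h0 -[- th p]sub0r vB v0 he.
have := hp p hb; case: ifP => _ H; last by rewrite H oppr0.
exact: (subspaceN (erb_sub E _ _)).
Qed.

Lemma zigzagB (th th' : forall p, bc_col C p) : zigzag n.+1 1 M th -> zigzag n.+1 1 M th' ->
  zigzag n.+1 1 M (fun p => th p - th' p).
Proof.
move=> z /zN z'; have := zigzag_lin 1 z z'.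
by congr (zigzag _ _ _ _); apply: functional_extensionality_dep => p; rewrite scale1r.
Qed.

(** Two zigzags with the same class in the last column differ by one whose last term
    is a vertical boundary, to which zigzag_trim applies. *)
Lemma ss_d_last th : zigzag n.+1 1 M th ->
  ss_d C n.+1 0 1 (ss_pi C n.+1 n.+1 1 (th n.+1)) = ss_pi C n.+1 0 n.+1 (h (th 1%N)).
Proof.
move=> zth; rewrite /ss_d; apply: xget_subset1 => /=.
  exists th; split=> //; first by rewrite add0n addn1.
  apply: (erb_v1 E); have := zth.1 n.+1; rewrite leqnn /= leqW //.
  by rewrite /M -[n.+2]addn1 addKn => /(_ isT).
suff H e' : (exists th' : forall p, bc_col C p,
    [/\ zigzag n.+1 1 (n.+1 + 1) th', v (th' n.+1) = 0,
        ss_pi C n.+1 n.+1 1 (th n.+1) = ss_pi C n.+1 n.+1 1 (th' n.+1) &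
        e' = ss_pi C n.+1 0 n.+1 (h (th' 1%N))]) -> e' = ss_pi C n.+1 0 n.+1 (h (th 1%N)).
  by move=> e1 e2 /H -> /H ->.
move=> [th' [zth' _ eq_pi ->]]; rewrite addn1 in zth'.
move/vpi_eq/(span_ss_B_last (ltn0Sn _)): eq_pi => [y Py vy].
apply/esym/vpi_eq/span_mem; rewrite -hB.
exact: zigzag_trim (zigzagB zth zth') Py vy.
Qed.

Lemma ss_page_lastP e : ss_page C n.+1 n.+1 1 e <->
  exists2 th, zigzag n.+1 1 M th & e = ss_pi C n.+1 n.+1 1 (th n.+1).
Proof.
split=> [[x [Px vx [th [<- zth]]] <-]|[th zth ->]].
  by exists th => //; move: zth; rewrite subSnn addn1.
exists (th n.+1) => //; have Pth : part n.+1 1 (th n.+1).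
  have := zth.1 n.+1; rewrite leqnn /= leqW //.
  by rewrite /M -[n.+2]addn1 addKn => /(_ isT).
split=> //; first exact: (erb_v1 E).
by exists th; split=> //; rewrite subSnn addn1.
Qed.

Lemma ss_page0P r e : ss_page C r.+1 0 n.+1 e <->
  exists x, [/\ part 0 n.+1 x, v x = 0 & e = ss_pi C r.+1 0 n.+1 x].
Proof.
split=> [[x [Px vx _] <-]|[x [Px vx ->]]]; first by exists x.
exists x => //; split=> //.
exists (@dfwith nat (bc_col C) (fun=> 0) 0 x); rewrite dfwith_in; split=> //.
split=> p; first by rewrite subSS sub0n leqn0 => /eqP ->; rewrite dfwith_in.
by rewrite ltn0 andbF.
Qed.

(** Surjectivity is zigzag_lift, and injectivity is last_boundary. *)
Theorem ss_d_last_bij :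
  set_bij (ss_page C n.+1 n.+1 1) (ss_page C n.+1 0 n.+1) (ss_d C n.+1 0 1).
Proof.
split.
- move=> _ /ss_page_lastP[th zth ->]; rewrite (ss_d_last zth).
  apply/ss_page0P; exists (h (th 1%N)); split=> //.
    by apply: (erb_hpart E); apply: (zth.1 1%N isT).
  rewrite -(erb_hv E); rewrite -(zth.2 1%N) /= ?ltnS ?n_gt0 //.
  exact: (erb_hh E).
- move=> e e'; rewrite !inE => /ss_page_lastP[th zth ->] /ss_page_lastP[th' zth' ->].
  rewrite (ss_d_last zth) (ss_d_last zth') => /vpi_eq/span_ss_B0.
  move=> [y [w [Py zw w0]]]; rewrite -hB => hth.
  have /= zw' := zigzagB (zigzagB zth zth') zw.
  have h1 : h (th 1%N - th' 1%N - w 1%N) = v y by rewrite hB hth addrK.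
  have [yy Pyy vyy] := last_boundary zw' Py h1.
  move: vyy; rewrite w0 subr0 => vyy; apply/vpi_eq/span_mem.
  by rewrite vyy; apply: ss_B_vertical.
- move=> e /ss_page0P[x [Px vx ->]].
  have [th [zth hx]] := zigzag_lift Px vx (leqnn n).
  exists (ss_pi C n.+1 n.+1 1 (th n.+1)); last by rewrite ss_d_last ?hx.
  by apply/ss_page_lastP; exists th.
Qed.

End LastDifferential.

(** * The Chevalley-Eilenberg differential *)

Lemma ext_cons_ind (k : fieldType) (V : lmodType k) (P : ext V -> Prop) :
  (forall a u v, P u -> P v -> P (a *: u + v)) -> P (wedge [::]) ->
  (forall x u, P u -> P (ext_cons x u)) -> forall u, P u.
Proof.
move=> Plin Pnil Pcons; have P0 : P 0 by rewrite -(addNr (wedge [::])) -scaleN1r; apply: Plin.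
elim/wedge_ind=> // a l u Pu; apply: Plin => //.
by elim: l => // x l IH; rewrite -ext_consE; apply: Pcons.
Qed.

Section Cartan.
Variables (k : fieldType) (A : algType k).
Implicit Types (x y : A) (u v : ext A).

Lemma ce_diff_is_linear : linear (@ce_diff k A).
Proof.
move=> a u v; rewrite /ce_diff.
have -> : @ce_diff_seq k A = @ce_rec k A by apply/funext => l; rewrite ce_recE.
exact/ext_liftP/ce_rec_compat.
Qed.
HB.instance Definition _ :=
  GRing.isLinear.Build k (ext A) (ext A) *:%R (@ce_diff k A) ce_diff_is_linear.

(** The Lie derivative along x, extending ad x to the exterior algebra as a
    derivation. *)
Definition lie_der x : ext A -> ext A := ext_lift (ce_ad x).

Lemma lie_der_is_linear x : linear (lie_der x).
Proof. by move=> a u v; apply/ext_liftP/ce_ad_compat. Qed.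
HB.instance Definition _ x :=
  GRing.isLinear.Build k (ext A) (ext A) *:%R (lie_der x) (lie_der_is_linear x).

Lemma lie_der_nil x : lie_der x (wedge [::]) = 0.
Proof. by rewrite /lie_der ext_lift_wedge //; apply: ce_ad_compat. Qed.

Lemma lie_der_cons x y u :
  lie_der x (ext_cons y u) = ext_cons (lbr x y) u + ext_cons y (lie_der x u).
Proof.
elim/wedge_ind: u => [|a l u IH]; first by rewrite !linear0 addr0.
rewrite !linearP /= IH [RHS]addrACA -scalerDr; congr (a *: _ + _).
by rewrite !ext_consE /lie_der !ext_lift_wedge //; apply: ce_ad_compat.
Qed.

Lemma ce_diff_nil : ce_diff (wedge [::] : ext A) = 0.
Proof. by rewrite ce_diff_wedge big_ord0. Qed.

(** Cartan's formula: minus the Lie derivative is the anticommutator of the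
    differential with exterior multiplication.  It reduces every property of the
    differential to an induction on decomposable elements. *)
Lemma ce_diff_cons x u :
  ce_diff (ext_cons x u) = - ext_cons x (ce_diff u) - lie_der x u.
Proof.
elim/wedge_ind: u => [|a l u IH]; first by rewrite !(linear0, oppr0, addr0).
rewrite !linearP /= IH [RHS]addrACA -scalerDr.
congr (a *: _ + _).
have e : @ce_diff_seq k A = @ce_rec k A by apply/funext => m; rewrite ce_recE.
rewrite ext_consE /ce_diff /lie_der e !ext_lift_wedge //;
  by [exact: ce_rec_compat | exact: ce_ad_compat].
Qed.

Lemma lbr_jacobi x y z : lbr (lbr x y) z = lbr x (lbr y z) - lbr y (lbr x z).
Proof.
rewrite /lbr !mulrBl !mulrBr !mulrA !opprB.
rewrite [RHS](AC ((2*2)*(2*2)) ((1*8)*(3*6)*(2*5)*(4*7))) /=.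
by rewrite addNr addr0 addNr addr0.
Qed.

Lemma ext_consB x y u : ext_cons (x - y) u = ext_cons x u - ext_cons y u.
Proof.
have -> : x - y = -1 *: y + x by rewrite scaleN1r addrC.
by rewrite ext_consDl scaleN1r addrC.
Qed.

(** On generators this is the Jacobi identity. *)
Lemma lie_der_lbr x y u :
  lie_der (lbr x y) u = lie_der x (lie_der y u) - lie_der y (lie_der x u).
Proof.
elim/ext_cons_ind: u => [a u v IHu IHv||z u IH].
- by rewrite !linearP /= IHu IHv [RHS]addrACA -scalerDr.
- by rewrite !(lie_der_nil, linear0, oppr0, addr0).
rewrite !lie_der_cons IH !linearD !linearN /= !lie_der_cons lbr_jacobi ext_consB !opprD.
rewrite [RHS](AC ((2*2)*(2*2)) ((1*5)*(4*8)*(2*7)*(3*6))) /=.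
by rewrite !subrr !addr0.
Qed.

Lemma lie_der_ce_diff x u : lie_der x (ce_diff u) = ce_diff (lie_der x u).
Proof.
elim/ext_cons_ind: u => [a u v IHu IHv||z u IH].
- by rewrite !linearP /= IHu IHv.
- by rewrite ce_diff_nil lie_der_nil !linear0.
rewrite ce_diff_cons lie_der_cons linearB linearN linearD /= !ce_diff_cons.
rewrite lie_der_cons IH lie_der_lbr opprB opprD.
rewrite [RHS](AC ((1*2)*2) ((1*4)*3*(2*5))) /=.
by rewrite subrr addr0.
Qed.

(** By Cartan's formula, the square of the differential commutes with exterior
    multiplication as soon as the differential commutes with Lie derivatives. *)
Lemma ce_diffK u : ce_diff (ce_diff u) = 0.
Proof.
elim/ext_cons_ind: u => [a u v IHu IHv||x u IH].
- by rewrite !linearP /= IHu IHv scaler0 addr0.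
- by rewrite ce_diff_nil linear0.
rewrite ce_diff_cons linearB linearN /= ce_diff_cons IH linear0 oppr0 sub0r opprK.
by rewrite lie_der_ce_diff subrr.
Qed.

End Cartan.

Section IdealSubcomplexes.
Variables (k : fieldType) (A : algType k).
Implicit Types (J : set A) (x y : A) (u v : ext A) (r : nat).

Lemma CE_subspace J r : subspace (CE J r).
Proof. by case: r => [|r]; apply: span_subspace. Qed.

Lemma CE_linear_sub (W : lmodType k) (f : ext A -> W) (B : set W) J r :
  linear f -> subspace B -> (r = 0%N -> B (f (wedge [::]))) ->
  (forall x l, J x -> (size l).+1 = r -> B (f (wedge (x :: l)))) ->
  forall u, CE J r u -> B (f u).
Proof.
move=> lf sB B0 BJ; have f0 : f 0 = 0.
  by have := lf (-1) 0 0; rewrite scaler0 addr0 scaleN1r addNr.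
have sfB : subspace [set u | B (f u)].
  by split=> [|a u v Bu Bv] /=; rewrite ?f0 ?lf; [exact: sB.1 | exact: sB.2].
case: r B0 BJ => [|r] B0 BJ; apply: (span_min sfB).
  by move=> _ ->; apply: B0.
by move=> _ [x Jx [l sl ->]]; apply: BJ; rewrite ?sl.
Qed.

Lemma CE_wedge J x l : J x -> CE J (size l).+1 (wedge (x :: l)).
Proof. by move=> Jx; apply: span_mem; exists x => //; exists l. Qed.

Lemma CE_wedgeT l : CE setT (size l) (wedge l : ext A).
Proof. by case: l => [|x l]; [apply: span_mem | apply: CE_wedge]. Qed.

Lemma CE_mono J J' r : J `<=` J' -> CE J r `<=` CE J' r.
Proof.
move=> JJ'; apply: (CE_linear_sub (f := id)) => [//||->|x l /JJ' Jx <-].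
- exact: CE_subspace.
- exact: span_mem.
- exact: CE_wedge.
Qed.

Lemma CE_cons J r x u : J x -> CE setT r u -> CE J r.+1 (ext_cons x u).
Proof.
move=> Jx; apply: (CE_linear_sub (f := ext_cons x) (@ext_consP _ _ x)) => [|->|y l _ <-].
- exact: CE_subspace.
- by rewrite ext_consE; apply: (CE_wedge [::]).
by rewrite ext_consE; apply: (CE_wedge (y :: l)).
Qed.

Lemma CE_consr J r y u : CE J r.+1 u -> CE J r.+2 (ext_cons y u).
Proof.
apply: (CE_linear_sub (f := ext_cons y) (@ext_consP _ _ y)) => [||x l Jx [<-]] //.
  exact: CE_subspace.
rewrite -ext_consE ext_consC ext_consE; apply: (subspaceN (CE_subspace _ _)).
by apply: CE_cons => //; apply: (CE_wedgeT (y :: l)).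
Qed.

Definition lie_ideal J := subspace J /\ forall x y, J x -> J (lbr x y).

Lemma lbrN x y : lbr y x = - lbr x y. Proof. by rewrite /lbr opprB. Qed.

Lemma lie_ideal_setT : lie_ideal [set: A].
Proof. by []. Qed.

Lemma CE_lie_der J r x u : lie_ideal J -> J x -> CE setT r u -> CE J r (lie_der x u).
Proof.
move=> iJ Jx; have H l : CE J (size l) (lie_der x (wedge l)).
  elim: l => [|y l IH]; first by rewrite lie_der_nil; apply: subspace0 (CE_subspace _ _).
  rewrite -ext_consE lie_der_cons; apply: (subspaceD (CE_subspace _ _)).
    by apply: CE_cons; [apply: iJ.2 | apply: CE_wedgeT].
  case: l IH => [_|z l]; last exact: CE_consr.
  by rewrite lie_der_nil linear0; apply: subspace0 (CE_subspace _ _).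
apply: (CE_linear_sub (lie_der_is_linear x)) => [|->|y l _ <-]; last exact: (H (y :: l)).
  exact: CE_subspace.
exact: (H [::]).
Qed.

Lemma CE_diff1 J u : CE J 1 u -> ce_diff u = 0.
Proof.
apply: (CE_linear_sub (@ce_diff_is_linear k A) (B := [set 0])) => [|//|x [|//] _ _] /=.
  by split=> // a x y -> ->; rewrite scaler0 addr0.
by rewrite ce_diff_wedge big_ord1 big_ord0.
Qed.

(** In Cartan's formula both terms of the differential of x /\ u contain a factor in
    J, either x itself or a bracket with x. *)
Lemma CE_diff J r u : lie_ideal J -> CE J r.+1 u -> CE J r (ce_diff u).
Proof.
move=> iJ; have HT l : CE setT (size l).-1 (ce_diff (wedge l) : ext A).
  elim: l => [|x [|y l] IH]; first by rewrite ce_diff_nil; apply: subspace0 (CE_subspace _ _).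
    by rewrite (@CE_diff1 setT) //;
      [apply: subspace0 (CE_subspace _ _) | apply: (CE_wedgeT [:: x])].
  rewrite -ext_consE ce_diff_cons; apply: (subspaceB (CE_subspace _ _)).
    by apply: (subspaceN (CE_subspace _ _)); apply: CE_cons.
  by apply: CE_lie_der => //; apply: (CE_wedgeT (y :: l)).
apply: (CE_linear_sub (@ce_diff_is_linear k A)) => [|//|x l Jx [<-]]; first exact: CE_subspace.
rewrite -ext_consE ce_diff_cons; apply: (subspaceB (CE_subspace _ _)).
  apply: (subspaceN (CE_subspace _ _)); case: l => [|y l].
    by rewrite ce_diff_nil linear0; apply: subspace0 (CE_subspace _ _).
  by apply: CE_cons => //; apply: (HT (y :: l)).
by apply: CE_lie_der => //; apply: CE_wedgeT.
Qed.

Lemma ext1_compat : ext_compat (fun l : seq A => if l is [:: x] then x else 0).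
Proof.
split=> [[|y [|? l]] [|? r] a x z|[|y [|? l]] [|? r] x] //=;
  by rewrite ?scaler0 ?addr0.
Qed.

Lemma ext1_is_linear : linear (@ext1 k A).
Proof. by move=> a u v; apply: ext_liftP; apply: ext1_compat. Qed.
HB.instance Definition _ :=
  GRing.isLinear.Build k (ext A) A *:%R (@ext1 k A) ext1_is_linear.

Lemma ext1_wedge x : ext1 (wedge [:: x]) = x.
Proof. by rewrite /ext1 ext_lift_wedge //; apply: ext1_compat. Qed.

Lemma ext1_CE J u : subspace J -> CE J 1 u -> J (ext1 u).
Proof.
by move=> sJ; apply: (CE_linear_sub ext1_is_linear) => // x [|//] Jx _; rewrite ext1_wedge.
Qed.

End IdealSubcomplexes.

(** * Functoriality of the exterior algebra *)

Section ExtMap.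
Variables (k : fieldType) (A : algType k) (q : {linear A -> A}).

Definition ext_map : ext A -> ext A := ext_lift (fun l => wedge (map q l)).

Lemma ext_map_compat : ext_compat (fun l => wedge (map q l)).
Proof.
split=> [l r a x y|l r x]; rewrite !map_cat /= ?linearP; first exact: wedgeP.
exact: wedge_alt.
Qed.

Lemma ext_map_is_linear : linear ext_map.
Proof. by move=> a u v; apply/ext_liftP/ext_map_compat. Qed.
HB.instance Definition _ :=
  GRing.isLinear.Build k (ext A) (ext A) *:%R ext_map ext_map_is_linear.

Lemma ext_map_wedge l : ext_map (wedge l) = wedge (map q l).
Proof. exact/ext_lift_wedge/ext_map_compat. Qed.

Lemma CE_ext_map J r u : (forall x, J x -> J (q x)) -> CE J r u -> CE J r (ext_map u).
Proof.
move=> qJ; apply: (CE_linear_sub ext_map_is_linear) => [|->|x l Jx <-]; first exact: CE_subspace.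
  by rewrite ext_map_wedge; apply: span_mem.
by rewrite ext_map_wedge /= -(size_map q); apply/CE_wedge/qJ.
Qed.

Lemma CE_ext_map_im J r u : (forall x, J (q x)) -> CE setT r u -> CE J r (ext_map u).
Proof.
move=> qJ; apply: (CE_linear_sub ext_map_is_linear) => [|->|x l _ <-]; first exact: CE_subspace.
  by rewrite ext_map_wedge; apply: span_mem.
by rewrite ext_map_wedge /= -(size_map q); apply/CE_wedge/qJ.
Qed.

(** Expanding x = q x + (x - q x) in every factor of a wedge and discarding the
    term where q x is taken everywhere leaves a factor x - q x in each term. *)
Lemma CE_ext_map_compl J r u : subspace J -> (forall x, J (x - q x)) -> CE setT r u ->
  CE J r (u - ext_map u).
Proof.
move=> sJ qJ; have H l : CE J (size l) (wedge l - ext_map (wedge l)).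
  elim: l => [|x l IH].
    by rewrite ext_map_wedge subrr; apply: subspace0 (CE_subspace _ _).
  rewrite ext_map_wedge [map _ _]/= -!ext_consE.
  have -> : ext_cons x (wedge l) - ext_cons (q x) (wedge (map q l)) =
      ext_cons (x - q x) (wedge l) + ext_cons (q x) (wedge l - ext_map (wedge l)).
    by rewrite ext_consB linearB /= ext_map_wedge addrA subrK.
  apply: (subspaceD (CE_subspace _ _)).
    by apply: CE_cons => //; apply: CE_wedgeT.
  case: l IH => [_|y l]; last exact: CE_consr.
  by rewrite ext_map_wedge subrr linear0; apply: subspace0 (CE_subspace _ _).
have sB : subspace [set v | CE J r (v - ext_map v)].
  split=> [|a v w Jv Jw] /=; first by rewrite linear0 subr0; apply: subspace0 (CE_subspace _ _).
  rewrite linearP opprD addrACA -scalerBr; exact: (CE_subspace _ _).2.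
apply: (@CE_linear_sub _ _ _ id _ setT r) sB _ _ _ => [//|->|x l _ <-]; last exact: (H (x :: l)).
exact: (H [::]).
Qed.

End ExtMap.

(** * Sums over sign vectors *)

Section UpdatedFamilies.
Variables (I T : finType).
Implicit Types (e : {ffun I -> T}) (r : seq I) (i j : I).

Definition setf (U : Type) (f : {ffun I -> U}) i (u : U) : {ffun I -> U} :=
  [ffun j => if j == i then u else f j].

Lemma setfE (U : Type) (f : {ffun I -> U}) i u : setf f i u i = u.
Proof. by rewrite ffunE eqxx. Qed.

Lemma setfNE (U : Type) (f : {ffun I -> U}) i j u : j != i -> setf f i u j = f j.
Proof. by rewrite ffunE => /negPf ->. Qed.

Lemma setf_setf (U : Type) (f : {ffun I -> U}) i u w :
  setf (setf f i u) i w = setf f i w.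
Proof. by apply/ffunP => j; rewrite !ffunE; case: eqP. Qed.

Lemma setf_id (U : Type) (f : {ffun I -> U}) i u : f i = u -> setf f i u = f.
Proof. by move=> fi; apply/ffunP => j; rewrite !ffunE; case: eqP => // ->. Qed.

Lemma setfC (U : Type) (f : {ffun I -> U}) i j u w : i != j ->
  setf (setf f i u) j w = setf (setf f j w) i u.
Proof.
move=> nij; apply/ffunP => l; rewrite !ffunE.
by case: (eqVneq l j) => // ->; rewrite eq_sym (negPf nij).
Qed.

Definition agree_off r e0 e := [forall j, (j \in r) || (e j == e0 j)].

(** Summing over the values off which a family may differ from a given one, one
    index at a time, replaces the distributivity of a product over a sum when the
    product is a composition of maps. *)
Lemma sum_agree_cons (V : nmodType) (F : {ffun I -> T} -> V) i r e0 : i \notin r ->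
  \sum_(e | agree_off (i :: r) e0 e) F e =
  \sum_b \sum_(e | agree_off r (setf e0 i b) e) F e.
Proof.
move=> ir; rewrite (partition_big (fun e : {ffun I -> T} => e i) xpredT) //=.
apply: eq_bigr => b _; apply: eq_bigl => e.
apply/andP/forallP => [[/forallP h /eqP eb] j|h].
  rewrite ffunE; have [->|ne] := eqVneq j i; first by rewrite eb eqxx orbT.
  by have := h j; rewrite inE (negPf ne).
split; last by have := h i; rewrite (negPf ir) /= setfE.
apply/forallP => j; have := h j; rewrite inE ffunE.
by case: (j == i).
Qed.

Lemma sum_agree_nil (V : nmodType) (F : {ffun I -> T} -> V) e0 :
  \sum_(e | agree_off [::] e0 e) F e = F e0.
Proof.
rewrite (big_pred1 e0) // => e; apply/forallP/eqP => [h|-> j]; last exact: eqxx.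
by apply/ffunP => j; apply/eqP/h.
Qed.

Lemma sum_agree_enum (V : nmodType) (F : {ffun I -> T} -> V) e0 :
  \sum_(e | agree_off (enum I) e0 e) F e = \sum_e F e.
Proof. by apply: eq_bigl => e; apply/forallP => j; rewrite mem_enum. Qed.

End UpdatedFamilies.

Lemma sum_antisym (V : zmodType) (n : nat) (F : 'I_n -> 'I_n -> V) :
  (forall i, F i i = 0) -> (forall i j, F i j = - F j i) ->
  \sum_i \sum_j F i j = 0.
Proof.
move=> F0 FN.
have split_i i : \sum_j F i j = \sum_(j < n | (i < j)%N) F i j + \sum_(j < n | (j < i)%N) F i j.
  rewrite (bigID (fun j : 'I_n => (i < j)%N)) /=; congr (_ + _).
  rewrite (bigD1 i) ?ltnn //= F0 add0r; apply: eq_bigl => j.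
  by rewrite -leqNgt ltn_neqAle andbC.
under eq_bigr do rewrite split_i.
rewrite big_split /= [X in _ + X](exchange_big_dep xpredT) //= -big_split big1 // => i _.
by rewrite -big_split big1 //= => j _; rewrite FN addNr.
Qed.

(** * Exactness of the rows *)

Section Rows.
Variables (k : fieldType) (n : nat) (V : lmodType k).
Local Notation sgn := {ffun 'I_n -> option bool}.
Implicit Types (s : sgn) (i j : 'I_n) (e : {ffun 'I_n -> bool}) (x y : {ffun sgn -> V}).

Definition zeros_above s i := #|[pred j : 'I_n | (i < j)%N && (s j == None)]|.
Local Notation sigma s i := ((-1) ^+ zeros_above s i : k).

Definition row_d x : {ffun sgn -> V} :=
  [ffun s : sgn => \sum_(i | s i != None) sigma s i *: x (setf s i None)].

Definition signed e : sgn := [ffun i => Some (e i)].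

Definition row_aug x : V := \sum_(e : {ffun _}) (\prod_i sg k (e i)) *: x (signed e).

Lemma row_dE x s : row_d x s = \sum_(i | s i != None) sigma s i *: x (setf s i None).
Proof. exact: ffunE. Qed.

Lemma row_d_is_linear : linear row_d.
Proof.
move=> a x y; apply/ffunP => s; rewrite !ffunE scaler_sumr -big_split /=.
by apply: eq_bigr => i _; rewrite !ffunE scalerDr !scalerA mulrC.
Qed.
HB.instance Definition _ :=
  GRing.isLinear.Build k {ffun sgn -> V} {ffun sgn -> V} *:%R row_d row_d_is_linear.

Lemma row_aug_is_linear : linear row_aug.
Proof.
move=> a x y; rewrite /row_aug scaler_sumr -big_split /=.
by apply: eq_bigr => e _; rewrite !ffunE scalerDr !scalerA mulrC.
Qed.
HB.instance Definition _ :=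
  GRing.isLinear.Build k {ffun sgn -> V} V *:%R row_aug row_aug_is_linear.

Lemma zeros_above_set s i j : s i != None ->
  zeros_above (setf s i None) j = (zeros_above s j + (j < i))%N.
Proof.
move=> si; rewrite /zeros_above (cardD1 i) inE setfE eqxx andbT addnC; congr (_ + _)%N.
apply: eq_card => l; rewrite !inE ffunE.
by have [->|] := eqVneq l i => //=; rewrite (negPf si) andbF.
Qed.

Lemma sigma_set s i j : s i != None ->
  sigma (setf s i None) j = sigma s j * (-1) ^+ (j < i)%N.
Proof. by move=> si; rewrite zeros_above_set // exprD. Qed.

Lemma sigmaK s i (v : V) : sigma s i *: (sigma s i *: v) = v.
Proof. by rewrite scalerA -exprMn mulrNN mul1r expr1n scale1r. Qed.

Lemma signN1_neq i j : i != j -> (-1) ^+ (i < j)%N = - (-1) ^+ (j < i)%N :> k.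
Proof.
rewrite -val_eqE neq_ltn => /orP[] lt; rewrite lt ltnNge ltnW //=.
by rewrite expr1 expr0 opprK.
Qed.

(** Setting two signs to 0 in the two possible orders gives opposite coefficients,
    since exactly one of the two places lies above the other. *)
Lemma row_dd x : row_d (row_d x) = 0.
Proof.
apply/ffunP => s; rewrite !ffunE.
pose F i j := if [&& s i != None, s j != None & i != j]
  then (sigma s i * sigma s j * (-1) ^+ (j < i)%N) *: x (setf (setf s i None) j None)
  else 0.
rewrite -[RHS](@sum_antisym V n F); last 2 first.
- by move=> i; rewrite /F eqxx !andbF.
- move=> i j; rewrite /F (eq_sym j i) andbCA; case: ifP; rewrite ?oppr0 //.
  case/and3P=> _ _ nij; rewrite (signN1_neq nij) setfC // -scaleNr; congr (_ *: _).
  by rewrite mulrN opprK [sigma s j * _]mulrC.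
rewrite big_mkcond; apply: eq_bigr => i _; rewrite /F.
case: ifP => si /=; last by rewrite big1.
rewrite ffunE scaler_sumr big_mkcond; apply: eq_bigr => j _.
rewrite ffunE; have [->|nji] := eqVneq j i; first by rewrite /= andbF.
by rewrite andbT; case: ifP => // sj; rewrite sigma_set // scalerA mulrA.
Qed.

Lemma sigma_signed e i : sigma (signed e) i = 1.
Proof. by rewrite /zeros_above eq_card0 // => j; rewrite !inE ffunE andbF. Qed.

(** Two multi-signs that differ in the i-th sign only have opposite coefficients, and
    become equal when this sign is set to 0. *)
Lemma row_aug_d x : row_aug (row_d x) = 0.
Proof.
rewrite /row_aug.
under eq_bigr => e _.
  rewrite ffunE scaler_sumr big_mkcond /=.
  under eq_bigr => i _ do rewrite ffunE /= sigma_signed scale1r.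
  over.
rewrite exchange_big big1 //= => i _.
rewrite (bigID (fun e : {ffun 'I_n -> bool} => e i)) /=.
rewrite [X in _ + X](reindex_onto (fun e => setf e i false) (fun e => setf e i true)) /=.
  rewrite [X in _ + X](eq_bigl (fun e : {ffun 'I_n -> bool} => e i)); last first.
    move=> e; rewrite setfE /= setf_setf; apply/eqP/idP => [<-|ei].
      by rewrite setfE.
    exact: setf_id.
  rewrite -big_split big1 //= => e ei.
  have -> : setf (signed (setf e i false)) i None = setf (signed e) i None.
    by apply/ffunP => j; rewrite !ffunE; case: eqP.
  rewrite -scalerDl (bigD1 i) //= [X in _ + X](bigD1 i) //= setfE ei /sg mul1r mulN1r.
  rewrite [X in _ - X](eq_bigr (fun j => if e j then 1 else -1)); last first.
    by move=> j nj; rewrite setfNE.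
  by rewrite subrr scale0r.
by move=> e /negPf ei; rewrite setf_setf setf_id.
Qed.


(** ** The homotopies *)

Variable N : 'I_n -> bool -> V -> V.
Hypothesis Nlin : forall i b, linear (N i b).
Hypothesis N_id : forall i v, N i true v + N i false v = v.

Let N0 i b : N i b 0 = 0.
Proof. by have := Nlin i b (-1) 0 0; rewrite scaler0 addr0 scaleN1r addNr. Qed.
Let ND i b v w : N i b (v + w) = N i b v + N i b w.
Proof. by have := Nlin i b 1 v w; rewrite !scale1r. Qed.
Let NZ i b a v : N i b (a *: v) = a *: N i b v.
Proof. by have := Nlin i b a v 0; rewrite !addr0 N0 addr0. Qed.
Let Nsum i b (J : Type) (r : seq J) (P : pred J) (F : J -> V) :
  N i b (\sum_(j <- r | P j) F j) = \sum_(j <- r | P j) N i b (F j).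
Proof. by elim/big_rec2: _ => // j v w _ <-; rewrite ND. Qed.

Definition row_h i x : {ffun sgn -> V} := [ffun s : sgn =>
  if s i == None then sigma s i *:
    (N i false (x (setf s i (Some true))) + N i true (x (setf s i (Some false))))
  else 0].

Definition row_pr i x : {ffun sgn -> V} := [ffun s : sgn =>
  (if s i is Some b then sg k b *:
    N i b (x (setf s i (Some true)) - x (setf s i (Some false)))
  else 0) : V].

Lemma row_hE i x s : row_h i x s = if s i == None then sigma s i *:
    (N i false (x (setf s i (Some true))) + N i true (x (setf s i (Some false))))
  else 0.
Proof. exact: ffunE. Qed.

Lemma row_prE i x s : row_pr i x s = if s i is Some b then sg k b *:
    N i b (x (setf s i (Some true)) - x (setf s i (Some false))) else 0.
Proof. exact: ffunE. Qed.

(** In the i-th place the row is the two-term complex that embeds the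
    intersection of two subspaces diagonally into their direct sum; N i splits it,
    and row_pr i is the projection onto the splitting of its cokernel. *)
Lemma row_homotopy i x : x = row_d (row_h i x) + row_h i (row_d x) + row_pr i x.
Proof.
apply/ffunP => s.
transitivity (row_d (row_h i x) s + row_h i (row_d x) s + row_pr i x s); last first.
  by rewrite [RHS]ffunE [X in _ = X + _]ffunE.
rewrite row_dE [row_h i (row_d x) s]row_hE row_prE; case si : (s i) => [b|] /=.
  rewrite addr0 (bigD1 i) ?si //= big1 ?addr0; last first.
    by move=> j /andP[_ nji]; rewrite row_hE setfNE 1?eq_sym // si scaler0.
  rewrite row_hE setfE eqxx sigma_set ?si // ltnn mulr1 sigmaK !setf_setf.
  rewrite ND -[- x _]scaleN1r NZ.
  case: b si => si; rewrite /sg ?scale1r !scaleN1r ?opprD ?opprK.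
    by rewrite addrACA subrr addr0 addrC N_id setf_id.
  by rewrite addrACA subrr add0r N_id setf_id.
rewrite addr0.
pose K b := setf s i (Some b).
have KNone b : setf (K b) i None = s by rewrite setf_setf setf_id.
have Ki b : K b i != None by rewrite setfE.
have sK b j : sigma (K b) j = sigma s j * (-1) ^+ (j < i)%N.
  by rewrite -[in RHS](KNone b) sigma_set // -mulrA -expr2 sqrr_sign mulr1.
pose y b j := x (setf (K b) j None).
pose G j := N i false (y true j) + N i true (y false j).
have Kd b : row_d x (K b) = sigma s i *: x s +
    \sum_(j | s j != None) (sigma s j * (-1) ^+ (j < i)%N) *: y b j.
  rewrite row_dE (bigD1 i) //= KNone sK ltnn mulr1; congr (_ + _).
  apply: eq_big => [j|j _]; last by rewrite sK.
  by have [->|ne] := eqVneq j i; rewrite ?andbF ?si // setfNE // andbT.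
rewrite -/(K true) -/(K false) !Kd !ND !NZ !Nsum addrACA.
rewrite -scalerDr [N i false _ + _]addrC N_id scalerDr sigmaK addrCA.
rewrite -[LHS]addr0; congr (_ + _); apply/esym.
rewrite -big_split scaler_sumr -big_split big1 //= => j sj.
have nji : j != i by apply: contraNneq sj => ->; rewrite si.
rewrite row_hE setfNE 1?eq_sym // si eqxx sigma_set // !(setfC _ _ _ nji) -/(K true) -/(K false).
rewrite !NZ -!scalerDr -/(y true j) -/(y false j) -/(G j) !scalerA -scalerDl.
by rewrite (signN1_neq nji) !mulrN [X in _ - X]mulrCA subrr scale0r.
Qed.

Variables (X : 'I_n -> option bool -> set V) (XT : set V).
Hypothesis Xsub : forall i u, subspace (X i u).
Hypothesis XTsub : subspace XT.
Hypothesis XNone : forall i v, X i None v <-> X i (Some true) v /\ X i (Some false) v.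
Hypothesis X_XT : forall i u v, X i u v -> XT v.
Hypothesis NX : forall i b j u v, X j u v -> X j u (N i b v).
Hypothesis N_im : forall i b v, XT v -> X i (Some b) (N i b v).

Definition row_part p x := forall s,
  if sdeg s == p.+1 then forall i, X i (s i) (x s) else x s = 0.

Lemma row_partE p x s i : row_part p x -> X i (s i) (x s).
Proof.
by move=> /(_ s); case: ifP => [_ //|_ ->]; apply: subspace0 (Xsub _ _).
Qed.

Lemma X_None i b v : X i None v -> X i (Some b) v.
Proof. by move=> /XNone[]; case: b. Qed.

Lemma sdeg_set s i : s i != None -> sdeg (setf s i None) = (sdeg s).+1.
Proof.
move=> si; rewrite /sdeg (cardD1 i) inE setfE eqxx; congr _.+2.
apply: eq_card => j; rewrite !inE ffunE.
by have [->|_ //] := eqVneq j i; rewrite (negPf si).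
Qed.

Lemma sdeg_set_some s i b c : s i = Some c -> sdeg (setf s i (Some b)) = sdeg s.
Proof.
move=> si; rewrite /sdeg; congr _.+1; apply: eq_card => j; rewrite !inE ffunE.
by have [->|//] := eqVneq j i; rewrite si.
Qed.

Lemma sdeg_unset s i b : s i = None -> sdeg s = (sdeg (setf s i (Some b))).+1.
Proof. by move=> si; rewrite -(@sdeg_set _ i) ?setfE // setf_setf setf_id. Qed.

Lemma row_part_subspace p : subspace [set x | row_part p x].
Proof.
split=> [s|a x y Px Py s] /=; rewrite !ffunE.
  by case: ifP => // _ i; apply: subspace0 (Xsub _ _).
have := Px s; have := Py s; case: ifP => _ Hy Hx; last by rewrite Hx Hy scaler0 addr0.
by move=> i; apply: (Xsub _ _).2.
Qed.

Lemma row_d_part p x : row_part p.+1 x -> row_part p (row_d x).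
Proof.
move=> Px s; rewrite row_dE; case: ifP => sp => [i|].
  apply: (subspace_sum (Xsub _ _)) => j sj; apply: (subspaceZ (Xsub _ _)).
  have := row_partE (setf s j None) i Px; have [->|ne] := eqVneq i j.
    by rewrite setfE; move: sj; case: (s j) => // b _; apply: X_None.
  by rewrite setfNE.
rewrite big1 // => j sj; have := Px (setf s j None).
by rewrite sdeg_set // eqSS sp => ->; rewrite scaler0.
Qed.

Lemma row_part_None x s i : row_part 0 x -> s i = None -> x s = 0.
Proof. by move=> Px si; have := Px s; rewrite (sdeg_unset true si). Qed.

Lemma row_d_part0 x : row_part 0 x -> row_d x = 0.
Proof.
move=> Px; apply/ffunP => s; rewrite row_dE big1 ?ffunE // => i si.
by rewrite (@row_part_None _ _ i) ?scaler0 // setfE.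
Qed.

Lemma row_h_part p i x : row_part p x -> row_part p.+1 (row_h i x).
Proof.
move=> Px s; rewrite row_hE; have [si|_] := eqVneq (s i) None; last first.
  by case: ifP => // _ j; apply: subspace0 (Xsub _ _).
have Dsi b : sdeg s = (sdeg (setf s i (Some b))).+1 by apply: sdeg_unset.
have XK b j : j != i -> X j (s j) (x (setf s i (Some b))).
  by move=> ne; have := row_partE (setf s i (Some b)) j Px; rewrite setfNE.
have XKi b : X i (Some b) (x (setf s i (Some b))).
  by have := row_partE (setf s i (Some b)) i Px; rewrite setfE.
case: ifP => [sp j|sp]; last first.
  have Z b : x (setf s i (Some b)) = 0.
    by have := Px (setf s i (Some b)); rewrite -eqSS -Dsi sp.
  by rewrite !Z !N0 addr0 scaler0.
apply: (subspaceZ (Xsub _ _)); apply: (subspaceD (Xsub _ _)).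
  have [->|ne] := eqVneq j i; last exact/NX/XK.
  by rewrite si; apply/XNone; split; [apply/NX/XKi | apply/N_im/X_XT/XKi].
have [->|ne] := eqVneq j i; last exact/NX/XK.
by rewrite si; apply/XNone; split; [apply/N_im/X_XT/XKi | apply/NX/XKi].
Qed.

Lemma row_pr_part p i x : row_part p x -> row_part p (row_pr i x).
Proof.
move=> Px s; rewrite row_prE; case si : (s i) => [b|]; last first.
  by case: ifP => // _ j; apply: subspace0 (Xsub _ _).
have XK c j : j != i -> X j (s j) (x (setf s i (Some c))).
  by move=> ne; have := row_partE (setf s i (Some c)) j Px; rewrite setfNE.
have XKi c : X i (Some c) (x (setf s i (Some c))).
  by have := row_partE (setf s i (Some c)) i Px; rewrite setfE.
case: ifP => [sp j|sp]; last first.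
  have Z c : x (setf s i (Some c)) = 0.
    by have := Px (setf s i (Some c)); rewrite (sdeg_set_some _ si) sp.
  by rewrite !Z subrr N0 scaler0.
apply: (subspaceZ (Xsub _ _)); have [->|ne] := eqVneq j i.
  by rewrite si; apply: N_im; apply: (subspaceB XTsub); apply/X_XT/XKi.
by apply: NX; apply: (subspaceB (Xsub _ _)); apply: XK.
Qed.

Lemma row_last p x : (n < p)%N -> row_part p x -> x = 0.
Proof.
move=> np Px; apply/ffunP => s; rewrite ffunE; have := Px s.
rewrite eqSS ltn_eqF // (leq_ltn_trans _ np) //.
by rewrite -[X in (_ <= X)%N]card_ord max_card.
Qed.

Definition row_prs r x := foldr row_pr x r.

Lemma row_prs_part p r x : row_part p x -> row_part p (row_prs r x).
Proof. by move=> Px; elim: r => //= i r IH; apply: row_pr_part. Qed.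

(** Each step of the iteration changes a cycle by a boundary only, so that a
    cycle bounds as soon as the composition of all the projections kills it. *)
Lemma row_prs_homotopic p r x : row_part p x -> row_d x = 0 ->
  exists2 y, row_part p.+1 y & x = row_d y + row_prs r x.
Proof.
move=> Px dx; elim: r => [|i r [y Py xE]] /=.
  by exists 0; [apply: subspace0 (row_part_subspace _) | rewrite linear0 add0r].
have dz : row_d (row_prs r x) = 0.
  by move/(congr1 row_d): xE; rewrite linearD /= row_dd add0r dx.
have Pz := row_prs_part r Px.
exists (y + row_h i (row_prs r x)).
  by apply: (subspaceD (row_part_subspace _)) => //; apply: row_h_part.
rewrite linearD /= -addrA [LHS]xE; congr (_ + _).
rewrite [LHS](row_homotopy i) dz.
have -> : row_h i 0 = 0 :> {ffun sgn -> V}.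
  by apply/ffunP => s; rewrite row_hE !ffunE !N0 addr0 scaler0 if_same.
by rewrite addr0.
Qed.

(** Each projection kills the multi-signs with a zero in its place, and from the
    second column on there are no others. *)
Lemma row_prs_None r x s i : i \in r -> s i = None -> row_prs r x s = 0.
Proof.
elim: r s => //= j r IH s; rewrite inE row_prE => ir si.
have [<-|nij] := eqVneq i j; first by rewrite si.
move: ir; rewrite (negPf nij) /= => ir.
by case: (s j) => // b; rewrite !IH ?setfNE // subrr N0 scaler0.
Qed.

Lemma row_exactS p x : row_part p.+1 x -> row_d x = 0 ->
  exists2 y, row_part p.+2 y & row_d y = x.
Proof.
move=> Px dx; have [y Py xE] := row_prs_homotopic (enum 'I_n) Px dx.
exists y => //; rewrite [RHS]xE; suff -> : row_prs (enum 'I_n) x = 0 by rewrite addr0.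
apply/ffunP => s; rewrite [RHS]ffunE; have := row_prs_part (enum 'I_n) Px s.
case: ifP => // /eqP sp _.
have /card_gt0P[i] : (0 < #|[pred i | s i == None]|)%N.
  by move: sp; rewrite /sdeg => -[->].
by rewrite inE => /eqP si; apply: row_prs_None si; rewrite mem_enum.
Qed.

Definition signed_N e r v := foldr (fun i v => N i (e i) v) v r.

Lemma signed_N_linear e r : linear (signed_N e r).
Proof. by move=> a v w; elim: r => //= i r ->; apply: Nlin. Qed.

Lemma signed_NB e r v w : signed_N e r (v - w) = signed_N e r v - signed_N e r w.
Proof. by rewrite addrC -scaleN1r signed_N_linear scaleN1r addrC. Qed.

Lemma signed_N_notin e r i b v : i \notin r ->
  signed_N (setf e i b) r v = signed_N e r v.
Proof.
elim: r => //= j r IH; rewrite inE negb_or => /andP[nij ir].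
by rewrite IH // setfNE // eq_sym.
Qed.

Lemma signed_setf e i b : setf (signed e) i (Some b) = signed (setf e i b).
Proof. by apply/ffunP => j; rewrite !ffunE; case: eqP. Qed.

(** On multi-signs without zeros the composition of the projections factors through
    the augmentation, so that it kills the cycles of the first column. *)
Lemma row_prs_signed r x e : uniq r -> row_prs r x (signed e) =
  (\prod_(i <- r) sg k (e i)) *: signed_N e r
    (\sum_(e' | agree_off r e e') (\prod_(i <- r) sg k (e' i)) *: x (signed e')).
Proof.
elim: r e => [|i r IH] e /=; first by rewrite sum_agree_nil !big_nil !scale1r.
case/andP=> ir ur; rewrite row_prE ffunE !signed_setf !IH // big_cons -scalerA.
have prodE b : \prod_(j <- r) sg k (setf e i b j) = \prod_(j <- r) sg k (e j).
  by apply: eq_big_seq => j jr; rewrite setfNE //; apply: contraNneq ir => <-.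
rewrite !prodE !signed_N_notin // -scalerBr NZ; congr (_ *: (_ *: N i _ _)).
rewrite sum_agree_cons // big_bool /= -signed_NB.
congr (signed_N e r (_ + _)); last rewrite -sumrN;
  apply: eq_bigr => e' /forallP/(_ i); rewrite (negPf ir) setfE /= => /eqP e'i;
  by rewrite big_cons e'i /sg ?mul1r // mulN1r scaleNr.
Qed.

Lemma row_exact0 x : row_part 0 x -> row_aug x = 0 ->
  exists2 y, row_part 1 y & row_d y = x.
Proof.
move=> Px ax; have [y Py xE] := row_prs_homotopic (enum 'I_n) Px (row_d_part0 Px).
exists y => //; rewrite [RHS]xE; suff -> : row_prs (enum 'I_n) x = 0 by rewrite addr0.
apply/ffunP => s; rewrite [RHS]ffunE; have [|s0] := eqVneq (sdeg s) 1%N; last first.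
  by have := row_prs_part (enum 'I_n) Px s; rewrite (negPf s0).
move=> [/card0_eq s0]; have -> : s = signed [ffun i => s i == Some true].
  apply/ffunP => i; rewrite !ffunE; have := s0 i; rewrite !inE.
  by case: (s i) => [[]|].
rewrite row_prs_signed ?enum_uniq // sum_agree_enum.
rewrite [X in signed_N _ _ X](_ : _ = 0).
  by have := signed_NB [ffun i => s i == Some true] (enum 'I_n) 0 0;
    rewrite !subrr => ->; rewrite scaler0.
by rewrite -[RHS]ax; apply: eq_bigr => e _; rewrite big_enum.
Qed.

Lemma signed_N_id r e v : uniq r ->
  \sum_(e' | agree_off r e e') signed_N e' r v = v.
Proof.
elim: r e => [|i r IH] e /=; first by rewrite sum_agree_nil.
case/andP=> ir ur; rewrite sum_agree_cons // -[RHS](N_id i) big_bool /=.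
have H b : \sum_(e' | agree_off r (setf e i b) e') N i (e' i) (signed_N e' r v) = N i b v.
  rewrite -[in RHS](IH (setf e i b) ur) Nsum; apply: eq_bigr => e' /forallP/(_ i).
  by rewrite (negPf ir) setfE => /eqP ->.
by rewrite !H.
Qed.

Lemma signed_N_XT e r v : XT v -> XT (signed_N e r v).
Proof. by move=> Tv; elim: r => //= i r IH; apply/X_XT/N_im. Qed.

Lemma signed_N_X e r i v : XT v -> i \in r -> X i (Some (e i)) (signed_N e r v).
Proof.
move=> Tv; elim: r => //= j r IH; rewrite inE => /predU1P[->|/IH]; last exact: NX.
exact/N_im/signed_N_XT.
Qed.

Lemma row_surj u : XT u -> exists2 y, row_part 0 y & row_aug y = u.
Proof.
move=> Tu; pose e_ (s : sgn) : {ffun 'I_n -> bool} := [ffun i => s i == Some true].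
exists [ffun s => if sdeg s == 1%N then
    (\prod_i sg k (e_ s i)) *: signed_N (e_ s) (enum 'I_n) u else 0].
  move=> s; rewrite ffunE; case: eqP => // -[/card0_eq s0] i.
  have -> : s i = Some (e_ s i).
    by rewrite ffunE; have := s0 i; rewrite !inE; case: (s i) => [[]|].
  by apply: (subspaceZ (Xsub _ _)); apply: signed_N_X; rewrite ?mem_enum.
rewrite -[RHS](signed_N_id [ffun=> true] _ (enum_uniq 'I_n)) sum_agree_enum.
apply: eq_bigr => e _; rewrite ffunE.
have -> : sdeg (signed e) = 1%N by rewrite /sdeg eq_card0 // => i; rewrite !inE ffunE.
have -> : e_ (signed e) = e by apply/ffunP => i; rewrite !ffunE; case: (e i).
rewrite eqxx scalerA -big_split big1 ?scale1r //= => i _.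
by rewrite /sg; case: ifP; rewrite ?mulr1 // mulrNN mulr1.
Qed.

Lemma row_aug_part x : (0 < n)%N -> row_part 0 x -> XT (row_aug x).
Proof.
move=> n0 Px; apply: (subspace_sum XTsub) => e _; apply: (subspaceZ XTsub).
exact: X_XT (row_partE (signed e) (Ordinal n0) Px).
Qed.

End Rows.

(** * Ideals of the iterated matrix algebra *)

Section Diagonal.
Variables (k : fieldType) (S : algType k).
Implicit Types (x y : bandmx S) (f : int -> S).

Lemma diag_banded f : (fun a b : int => if a == b then f a else 0) \in @banded k S.
Proof. by apply/asboolP; exists 0%N => a b; case: eqP => // ->; lia. Qed.
Definition diagmx f : bandmx S := BandMx (diag_banded f).

Lemma mulmxE x y a b K : (forall l, (K < `|a - l|)%N -> x a l = 0) ->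
  (x * y) a b = \sum_(l <- window a K) x a l * y l b.
Proof. exact: bmulE. Qed.

Lemma diagmx_mul f y a b : (diagmx f * y) a b = f a * y a b.
Proof.
rewrite (@mulmxE _ _ a b 0); last by move=> l h /=; case: eqP => //; lia.
by rewrite sum_window1 /= ?eqxx // => l h; rewrite eq_sym (negPf h) mul0r.
Qed.

Lemma mulmx_window x y : exists K, forall a b,
  (x * y) a b = \sum_(l <- window a K) x a l * y l b.
Proof. by have [K hK] := bandmx_band x; exists K => a b; apply/mulmxE/hK. Qed.

End Diagonal.

Section Ideals.
Variable k : fieldType.
Implicit Types (n i : nat) (e : bool).

Lemma idealE_out n e (x : Emx k n.+1) : ideal n e x <->
  exists B : int, forall a b : int, (if e then a < B else B < b) -> (x : bandmx _) a b = 0.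
Proof. by rewrite /= eqxx. Qed.

Lemma idealE_in n i e (x : Emx k n.+1) : i != n ->
  ideal i e x <-> forall a b : int, ideal i e ((x : bandmx _) a b).
Proof. by move=> /negPf /= ->. Qed.

Lemma ideal_subspace n i e : subspace (@ideal k n i e).
Proof.
elim: n => [|n IH] //; have [->|ne] := eqVneq i n; last first.
  split=> [|c x y]; first by apply/idealE_in => // a b; apply: subspace0 IH.
  move=> /(idealE_in _ _ ne) Ix /(idealE_in _ _ ne) Iy; apply/idealE_in => // a b.
  exact: (IH.2 c (x a b) (y a b)).
split=> [|c x y]; first by apply/idealE_out; exists 0.
move=> /idealE_out[B hB] /idealE_out[C hC]; apply/idealE_out.
exists (if e then Order.min B C else Order.max B C) => a b h.
transitivity (c *: (x : bandmx _) a b + (y : bandmx _) a b) => //.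
by rewrite hB ?hC ?scaler0 ?addr0 //; move: h; case: (e) => h; lia.
Qed.

Lemma ideal_mul n i e (x y : Emx k n) : ideal i e x \/ ideal i e y -> ideal i e (x * y).
Proof.
elim: n x y => [|n IH] // x y; have [K hK] := mulmx_window (x : bandmx _) (y : bandmx _).
have [->|ne] := eqVneq i n; last first.
  move=> h; apply/idealE_in => // a b; rewrite hK; apply: (subspace_sum (ideal_subspace _ _ _)).
  by move=> l _; apply: IH; case: h => /(idealE_in _ _ ne) h; [left | right].
have [L hL] := bandmx_band (x : bandmx _); have [M hM] := bandmx_band (y : bandmx _).
(* Multiplication by a band matrix moves the bound by at most its width. *)
case=> /idealE_out[B hB]; apply/idealE_out.
- exists (if e then B else B + M%:Z) => a b h; rewrite hK big1 // => l _.
  have [lM|Ml] := leqP `|l - b| M; last by rewrite [X in _ * X]hM ?mulr0.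
  by rewrite [X in X * _]hB ?mul0r //; move: h; case: (e) => h; lia.
- exists (if e then B - L%:Z else B) => a b h; rewrite hK big1 // => l _.
  have [lL|Ll] := leqP `|a - l| L; last by rewrite [X in X * _]hL ?mul0r.
  by rewrite [X in _ * X]hB ?mulr0 //; move: h; case: (e) => h; lia.
Qed.

Lemma ideal_lie n i e : lie_ideal (@ideal k n i e).
Proof.
split=> [|x y Ix]; first exact: ideal_subspace.
by apply: (subspaceB (ideal_subspace _ _ _)); apply: ideal_mul; [left | right].
Qed.

Lemma ideal_proj n i e : ideal i e (proj k n i e).
Proof.
elim: n => [|n IH] //; have [->|ne] := eqVneq i n.
  apply/idealE_out; exists 0 => a b; rewrite /proj /= eqxx.
  case: e {IH} => h; rewrite /bscal /cut /=.
    by rewrite [0 <= a]leNgt h andbF scale0r.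
  change ((if a == b then 1 else 0 : Emx k n) - ((a == b) && (0 <= a))%:R *: 1 = 0).
  case: eqP => [->|_]; last by rewrite scale0r subrr.
  by rewrite ltW // scale1r subrr.
apply/idealE_in => // a b; have pE : (proj k n.+1 i e : bandmx _) a b =
    if a == b then proj k n i e else 0.
  rewrite /proj /= (negPf ne); case: (e) => //.
  change ((if a == b then 1 else 0 : Emx k n) - (if a == b then place n i (cut k) else 0)
    = if a == b then 1 - place n i (cut k) else 0).
  by case: ifP => // _; rewrite subrr.
by rewrite pE; case: ifP => _ //; apply: subspace0 (ideal_subspace _ _ _).
Qed.

(** The ideals have no unit, but any finite set of elements has a common left
    unit: a projection with a cut chosen, in each entry, beyond the supports of
    the finitely many elements. *)
Lemma ideal_local_unit n i e (xs : seq (Emx k n)) :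
  (forall x, x \in xs -> ideal i e x) ->
  exists2 u : Emx k n, ideal i e u & forall x, x \in xs -> u * x = x.
Proof.
elim: n xs => [|n IH] xs Ixs; first by exists 1 => // x _; rewrite mul1r.
have [K hK] : exists K : nat, forall x, x \in xs -> forall a b : int,
    (K < `|a - b|)%N -> (x : bandmx _) a b = 0.
  elim: xs {Ixs} => [|x xs [K hK]]; first by exists 0%N.
  have [L hL] := bandmx_band (x : bandmx _); exists (maxn K L) => y.
  by rewrite inE => /predU1P[->|/hK {}hK] a b h; [apply: hL | apply: hK]; lia.
have [ei|ne] := eqVneq i n.
  have [B hB] : exists B : int, forall x, x \in xs -> forall a b : int,
      (if e then a < B else B < a) -> (x : bandmx _) a b = 0.
    elim: xs Ixs hK => [|x xs IHs] Ixs hK; first by exists 0.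
    have [||B hB] := IHs.
    - by move=> y ys; apply: Ixs; rewrite inE ys orbT.
    - by move=> y ys; apply: hK; rewrite inE ys orbT.
    have := Ixs x (mem_head _ _); rewrite ei => /idealE_out[C hC].
    exists (if e then Order.min B C else Order.max B (C + K%:Z)) => y.
    rewrite inE => /predU1P[->|ys] a b h; last first.
      by apply: hB => //; move: h; case: (e) => h; lia.
    have [lK|Kl] := leqP `|a - b| K; last by apply: hK Kl; apply: mem_head.
    by apply: hC; move: h; case: (e) => h; lia.
  exists (diagmx (fun a => if (if e then a < B else B < a) then 0 else 1 : Emx k n)).
    rewrite ei; apply/idealE_out; exists B => a b h /=; case: eqP => // ab; rewrite -ab in h.
    by rewrite h.
  move=> x xs0; apply: bandmx_eqP => a b; rewrite diagmx_mul.
  by case: ifP => h; rewrite ?mul1r // hB ?mulr0.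
have /choice[u hu] : forall a : int, exists u : Emx k n, ideal i e u /\
    forall x b, x \in xs -> u * (x : bandmx _) a b = (x : bandmx _) a b.
  move=> a; have [|u Iu hu] := IH [seq (x : bandmx _) a b | x <- xs, b <- window a K].
    by move=> _ /allpairsP[[x b] /= [xs0 _ ->]]; have /(idealE_in _ _ ne) := Ixs x xs0.
  exists u; split=> // x b xs0; have [lK|Kl] := leqP `|a - b| K.
    by apply: hu; apply/allpairsP; exists (x, b); rewrite mem_window.
  by rewrite hK ?mulr0.
exists (diagmx u).
  apply/idealE_in => // a b /=; case: ifP => _; first exact: (hu a).1.
  exact: subspace0 (ideal_subspace _ _ _).
by move=> x xs0; apply: bandmx_eqP => a b; rewrite diagmx_mul (hu a).2.
Qed.

End Ideals.

(** * The iterated trace *)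

Section Trace.
Variable k : fieldType.
Implicit Types (n i : nat) (e : bool).

Lemma Itr_subspace n : subspace (@Itr k n).
Proof.
split=> [i|a x y Ix Iy i]; first by split; exact: (subspace0 (ideal_subspace k n i _)).
have [[x1 x2] [y1 y2]] := (Ix i, Iy i).
by split; apply: (ideal_subspace k n i _).2.
Qed.

Lemma Itr_entry n (x : Emx k n.+1) a b : Itr x -> Itr ((x : bandmx _) a b).
Proof.
move=> Ix i; have [I1 I2] := Ix (widen_ord (leqnSn n) i).
have ne : (i : nat) != n by rewrite ltn_eqF.
by split; [exact: ((idealE_in true x ne).1 I1 a b) | exact: ((idealE_in false x ne).1 I2 a b)].
Qed.

(** For each place and each direction one of the two factors has bounded support;
    this is what makes the double sums for tr (x * g) and tr (g * x) finite. *)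
Definition balanced n (x g : Emx k n) :=
  forall (i : 'I_n) e, ideal i e x \/ ideal i e g.

Lemma balancedC n (x g : Emx k n) : balanced x g -> balanced g x.
Proof. by move=> b i e; case: (b i e); [right | left]. Qed.

Lemma balanced_Itr n (x g : Emx k n) : balanced x g -> Itr (x * g).
Proof. by move=> b i; split; apply: ideal_mul. Qed.

Lemma balanced_entry n (x g : Emx k n.+1) a b c d : balanced x g ->
  balanced ((x : bandmx _) a b) ((g : bandmx _) c d).
Proof.
move=> bxg i e; have ne : (i : nat) != n by rewrite ltn_eqF.
case: (bxg (widen_ord (leqnSn n) i) e) => h; [left | right].
  exact: ((idealE_in e x ne).1 h a b).
exact: ((idealE_in e g ne).1 h c d).
Qed.

Lemma Itr_support n (x : Emx k n.+1) : Itr x ->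
  exists M : nat, forall a b : int, (M < `|a|)%N -> (x : bandmx _) a b = 0.
Proof.
move=> /(_ ord_max)[/idealE_out[B hB] /idealE_out[C hC]].
have [K hK] := bandmx_band (x : bandmx _); exists (`|B| + `|C| + K)%N => a b h.
have [lK|] := leqP `|a - b| K; last exact: hK.
have [lB|Bl] := ltP a B; first exact: hB.
by apply: hC; lia.
Qed.

Lemma tr_window n (x : Emx k n.+1) (M : nat) :
  (forall a : int, (M < `|a|)%N -> (x : bandmx _) a a = 0) ->
  tr x = tr (\sum_(a <- window 0 M) (x : bandmx _) a a).
Proof.
move=> h; rewrite /=; congr tr; apply: fsbig_window => a ha; apply: h.
by move: ha; rewrite sub0r; lia.
Qed.

Lemma tr_lin n c (x y : Emx k n) : Itr x -> Itr y -> tr (c *: x + y) = c * tr x + tr y.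
Proof.
elim: n c x y => [|n IH] // c x y Ix Iy.
have [M hM] := Itr_support Ix; have [L hL] := Itr_support Iy.
rewrite (@tr_window _ x (M + L)); last by move=> a h; apply: hM; lia.
rewrite (@tr_window _ y (M + L)); last by move=> a h; apply: hL; lia.
rewrite -IH; first last.
- by apply: (subspace_sum (Itr_subspace _)) => a _; apply: Itr_entry.
- by apply: (subspace_sum (Itr_subspace _)) => a _; apply: Itr_entry.
rewrite (@tr_window _ _ (M + L)).
  by congr tr; rewrite scaler_sumr -big_split.
move=> a h; transitivity (c *: (x : bandmx _) a a + (y : bandmx _) a a) => //.
by rewrite hM ?hL ?scaler0 ?addr0 //; lia.
Qed.

Lemma tr0 n : tr (0 : Emx k n) = 0.
Proof.
have I0 := subspace0 (Itr_subspace n).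
by have := tr_lin 1 I0 I0; rewrite scaler0 addr0 mul1r -[LHS]addr0 => /addrI.
Qed.

Lemma trZ n c (x : Emx k n) : Itr x -> tr (c *: x) = c * tr x.
Proof.
move=> Ix; have := tr_lin c Ix (subspace0 (Itr_subspace n)).
by rewrite tr0 !addr0.
Qed.

Lemma trD n (x y : Emx k n) : Itr x -> Itr y -> tr (x + y) = tr x + tr y.
Proof. by move=> Ix Iy; have := tr_lin 1 Ix Iy; rewrite scale1r mul1r. Qed.

Lemma tr_sum n (J : Type) (r : seq J) (F : J -> Emx k n) : (forall j, Itr (F j)) ->
  tr (\sum_(j <- r) F j) = \sum_(j <- r) tr (F j).
Proof.
move=> IF; elim: r => [|j r IH]; first by rewrite !big_nil tr0.
rewrite !big_cons trD ?IH //.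
by apply: (subspace_sum (Itr_subspace _)).
Qed.

Lemma balanced_support n (x g : Emx k n.+1) : balanced x g ->
  exists M : nat, forall a b : int, (M < `|a|)%N || (M < `|b|)%N ->
    (x : bandmx _) a b = 0 \/ (g : bandmx _) b a = 0.
Proof.
move=> bxg; have [K hK] := bandmx_band (x : bandmx _).
have [L hL] := bandmx_band (g : bandmx _).
have [B hB] : exists B : int, forall a b : int, (a < B) || (b < B) ->
    (x : bandmx _) a b = 0 \/ (g : bandmx _) b a = 0.
  case: (bxg ord_max true) => /idealE_out[B hB]; exists (B - K%:Z - L%:Z) => a b h.
    by left; have [lK|/hK //] := leqP `|a - b| K; apply: hB; lia.
  by right; have [lL|/hL //] := leqP `|b - a| L; apply: hB; lia.
have [C hC] : exists C : int, forall a b : int, (C < a) || (C < b) ->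
    (x : bandmx _) a b = 0 \/ (g : bandmx _) b a = 0.
  case: (bxg ord_max false) => /idealE_out[C hC]; exists (C + K%:Z + L%:Z) => a b h.
    by left; have [lK|/hK //] := leqP `|a - b| K; apply: hC; lia.
  by right; have [lL|/hL //] := leqP `|b - a| L; apply: hC; lia.
exists (`|B| + `|C|)%N => a b h.
have [h1|h1] := boolP ((a < B) || (b < B)); first exact: hB.
by apply: hC; lia.
Qed.

Lemma tr_mul_double n (x g : Emx k n.+1) (M : nat) :
  balanced x g -> (forall a b : int, (M < `|a|)%N || (M < `|b|)%N ->
    (x : bandmx _) a b = 0 \/ (g : bandmx _) b a = 0) ->
  tr (x * g) = \sum_(a <- window 0 M) \sum_(b <- window 0 M)
    tr ((x : bandmx _) a b * (g : bandmx _) b a).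
Proof.
move=> bxg hM; have diagE a : (x * g : bandmx _) a a =
    \sum_(b <- window 0 M) (x : bandmx _) a b * (g : bandmx _) b a.
  apply: fsbig_window => b; rewrite sub0r => h.
  by case: (hM a b) => [|->|->]; rewrite ?mul0r ?mulr0 //; lia.
rewrite (@tr_window _ _ M) => [|a h]; last first.
  rewrite diagE big1 // => b _.
  by case: (hM a b) => [|->|->]; rewrite ?mul0r ?mulr0 // h.
under eq_bigr do rewrite diagE.
have Iab a b : Itr ((x : bandmx _) a b * (g : bandmx _) b a).
  exact/balanced_Itr/balanced_entry.
rewrite tr_sum => [|a]; last by apply: (subspace_sum (Itr_subspace _)).
by apply: eq_bigr => a _; rewrite tr_sum.
Qed.

Lemma tr_mulC n (x g : Emx k n) : balanced x g -> tr (x * g) = tr (g * x).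
Proof.
elim: n x g => [|n IH] x g bxg; first exact: mulrC.
have [M hM] := balanced_support bxg.
rewrite (tr_mul_double bxg hM) (@tr_mul_double _ _ _ M (balancedC bxg)); last first.
  by move=> a b h; case: (hM b a); [rewrite orbC | right | left].
rewrite exchange_big; apply: eq_bigr => a _; apply: eq_bigr => b _.
exact/IH/balanced_entry.
Qed.

Lemma tr_lbr n (x g : Emx k n) : balanced x g -> Itr (lbr x g) /\ tr (lbr x g) = 0.
Proof.
move=> bxg; have [I1 I2] := (balanced_Itr bxg, balanced_Itr (balancedC bxg)).
split; first exact: (subspaceB (Itr_subspace _)).
rewrite /lbr trD // -?scaleN1r ?trZ //; last exact: (subspaceZ (Itr_subspace _)).
by rewrite (tr_mulC bxg) mulN1r subrr.
Qed.

End Trace.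

(** * Multiplication operators *)

Section Multiplication.
Variable k : fieldType.
Implicit Types (n i j : nat) (a b c d : int).

Lemma bscal_shift_mul (S : algType k) a (y : bandmx S) c d :
  (bscal S (shift k a) * y) c d = y (c - a) d.
Proof.
rewrite (@mulmxE _ _ _ _ c d `|a|%N) => [|l h] /=; last first.
  by case: eqP => [e|_]; [lia | exact: scale0r].
rewrite (bigD1_seq (c - a)).
- rewrite /= subrK eqxx scale1r mul1r big1 ?addr0 // => l nl.
  by case: (c =P l + a) nl => [->|_ _]; rewrite ?addrK ?eqxx // [X in X * _]scale0r mul0r.
- by rewrite mem_window; lia.
rewrite /window map_inj_uniq ?iota_uniq // => x y'; lia.
Qed.

Lemma bdiag_mul (S : algType k) (x : S) (y : bandmx S) c d :
  (bdiag x * y) c d = x * y c d.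
Proof. by rewrite -(diagmx_mul (fun=> x)); congr bandmx_val; congr (_ * _); apply: bandmx_eqP. Qed.

Lemma place_shiftC n i j a b :
  place n i (shift k a) * place n j (shift k b) =
  place n j (shift k b) * place n i (shift k a).
Proof.
elim: n => [|n IH] /=; first by [].
have H m (x : Emx k n) :
    bscal (Emx k n) (shift k m) * bdiag x = bdiag x * bscal (Emx k n) (shift k m).
  apply: bandmx_eqP => c d; rewrite bscal_shift_mul bdiag_mul /=.
  by rewrite subr_eq; case: eqP; rewrite ?scale1r ?scale0r ?mulr1 ?mulr0.
case: ifP => _; case: ifP => _.
- apply: bandmx_eqP => c d; rewrite !bscal_shift_mul /=; congr (_%:R *: _).
  by congr (nat_of_bool _); apply/eqP/eqP; lia.
- exact: H.
- by rewrite H.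
by apply: bandmx_eqP => c d; rewrite !bdiag_mul /=; case: ifP; rewrite ?mulr0.
Qed.

Lemma mulopE n (f : laurent k n) : mulop f = \sum_(lam <- dom f)
  coeff lam f *: \prod_(i < n) place n i (shift k (lam i)).
Proof.
rewrite /mulop -[in LHS](freeg_sumE f) raddf_sum /=.
by apply: eq_bigr => lam _; rewrite liftU.
Qed.

Lemma mulop_comm n (f g : laurent k n) : lbr (mulop f) (mulop g) = 0.
Proof.
suff H : GRing.comm (mulop f) (mulop g) by rewrite /lbr H subrr.
rewrite [mulop f]mulopE [mulop g]mulopE.
apply: GRing.commr_sum => lam _; apply/GRing.commr_sym.
apply: GRing.commr_sum => mu _; apply/GRing.commr_sym.
rewrite /GRing.comm -!scalerAl -!scalerAr scalerA mulrC -scalerA.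
congr (_ *: (_ *: _)); apply: GRing.commr_prod => i _; apply/GRing.commr_sym.
by apply: GRing.commr_prod => j _; apply: place_shiftC.
Qed.

End Multiplication.

(** * The trace vanishes on the boundaries of the last column *)

Section LeftMultiplication.
Variables (k : fieldType) (A : algType k).

Definition lmul (c x : A) : A := c * x.

Lemma lmul_is_linear c : linear (lmul c).
Proof. by move=> a x y; rewrite /lmul mulrDr scalerAr. Qed.
HB.instance Definition _ c := GRing.isLinear.Build k A A *:%R (lmul c) (lmul_is_linear c).

Lemma wedge2_expand (x y x' y' : A) :
  wedge [:: x + y; x' + y'] - wedge [:: y; y'] =
  wedge [:: x; x' + y'] + wedge [:: y; x'].
Proof.
have D (z t : A) (v : ext A) : ext_cons (z + t) v = ext_cons z v + ext_cons t v.
  by rewrite -[z]scale1r ext_consDl !scale1r.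
rewrite -!ext_consE !D !linearD /= -addrA; congr (_ + _).
by rewrite addrK.
Qed.

(** The elements of J that occur in a given element of J /\ ext A are finite in
    number, so that the local units of an ideal apply to them. *)
Lemma CE_support (J : set A) r (u : ext A) : CE J r.+1 u ->
  exists2 xs : seq A, (forall x, x \in xs -> J x) &
    forall q : {linear A -> A}, (forall x, x \in xs -> q x = 0) -> ext_map q u = 0.
Proof.
elim=> [|a z v [x Jx [l _ ->]] _ [xs Jxs hxs]].
  by exists [::] => // q _; rewrite linear0.
exists (x :: xs) => [y|q hq].
  by rewrite inE => /predU1P[->|/Jxs].
rewrite linearP /= ext_map_wedge /= hq ?mem_head // wedge0 scaler0 add0r.
by apply: hxs => y ys; apply: hq; rewrite inE ys orbT.
Qed.

End LeftMultiplication.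

Section BalancedBoundaries.
Variables (k : fieldType) (n : nat).
Local Notation A := (Emx k n).
Implicit Types (S : seq (nat * bool)) (x g : A) (u : ext A).

Definition balanced_for S : set (ext A) := [set u | exists x g,
  (forall p, p \in S -> ideal p.1 p.2 x \/ ideal p.1 p.2 g) /\ u = wedge [:: x; g]].

(** An element that lies in several of the subcomplexes need not be a sum of
    x /\ g with x in the intersection of the ideals; but it is a sum of x /\ g in
    which each of the ideals contains x or g.  To add one ideal, take a left unit c
    in it for the finitely many of its elements involved, and expand both factors by
    x = c x + (1 - c) x; the terms with 1 - c in both factors add up to 0. *)
Lemma CE_balanced S u : CE setT 2 u -> (forall p, p \in S -> CE (ideal p.1 p.2) 2 u) ->
  span (balanced_for S) u.
Proof.
move=> Tu; elim: S => [|[i e] S IH] Su.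
  move: Tu; apply: (CE_linear_sub (f := id)) => //; first exact: span_subspace.
  by move=> x [|g [|//]] // _ _; apply: span_mem; exists x, g.
have {}IH : span (balanced_for S) u.
  by apply: IH => p pS; apply: Su; rewrite inE pS orbT.
have [xs Ixs hxs] := CE_support (Su _ (mem_head _ _)).
have [c Ic cxs] := ideal_local_unit Ixs.
have qu : ext_map (lmul (1 - c)) u = 0.
  by apply: hxs => x xs0; rewrite /= /lmul mulrBl mul1r cxs // subrr.
rewrite -[u]subr0 -qu.
apply: (span_min (B := [set v | span (balanced_for ((i, e) :: S))
  (v - ext_map (lmul (1 - c)) v)])) IH.
  split=> [|a v w Sv Sw] /=; first by rewrite linear0 subr0; apply: span0.
  by rewrite linearP opprD addrACA -scalerBr; apply: (span_subspace _).2.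
move=> _ [x [g [Sxg ->]]] /=; rewrite ext_map_wedge /= /lmul.
have cK z : z = c * z + (1 - c) * z by rewrite -mulrDl addrC subrK mul1r.
rewrite {1}[x]cK {1}[g]cK wedge2_expand -cK; apply: span_add; apply: span_mem.
  exists (c * x), g; split=> // p; rewrite inE => /predU1P[->|pS].
    by left; apply: ideal_mul; left.
  by case: (Sxg p pS) => h; [left; apply: ideal_mul; right | right].
exists ((1 - c) * x), (c * g); split=> // p; rewrite inE => /predU1P[->|pS].
  by right; apply: ideal_mul; left.
by case: (Sxg p pS) => h; [left | right]; apply: ideal_mul; right.
Qed.

(** This is the reason why the trace is well defined on the last column, although an
    intersection of subcomplexes is not the subcomplex of the intersection. *)
Lemma tr_ce_diff u : (0 < n)%N -> (forall (i : 'I_n) e, CE (ideal i e) 2 u) ->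
  Itr (ext1 (ce_diff u)) /\ tr (ext1 (ce_diff u)) = 0.
Proof.
move=> n0 Iu; pose S := [seq (val i, e) | i <- enum 'I_n, e <- [:: true; false]].
have : span (balanced_for S) u.
  apply: CE_balanced => [|_ /allpairsP[[i e] [_ _ ->]]]; last exact: Iu.
  by apply: CE_mono (Iu (Ordinal n0) true).
apply: (span_min (B := [set u | Itr (ext1 (ce_diff u)) /\ tr (ext1 (ce_diff u)) = 0])).
  split=> [|a v w [Iv tv] [Iw tw]] /=; rewrite ?linear0 ?linearP /=.
    by split; [apply: subspace0 (Itr_subspace _ _) | apply: tr0].
  by rewrite tr_lin // tv tw mulr0 addr0; split=> //; apply: (Itr_subspace _ _).2.
move=> _ [x [g [Sxg ->]]] /=.
have bxg : balanced x g.
  move=> i e; apply: (Sxg (val i, e)); apply/allpairsP; exists (i, e).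
  by rewrite mem_enum /= !inE; case: e.
rewrite ce_diff_wedge !big_ord_recl !big_ord0 /= /bump /= !add0r !addr0 /=.
rewrite expr1 scaleN1r linearN /= ext1_wedge.
have [I0 t0] := tr_lbr bxg.
split; first exact: subspaceN (Itr_subspace _ _) _ _.
by rewrite -scaleN1r trZ // t0 mulr0.
Qed.

End BalancedBoundaries.

(** * The bicomplex of multi-signs *)

Section Rows.
Variables (k : fieldType) (n : nat).
Local Notation A := (Emx k n).
Implicit Types (i j : 'I_n) (b : bool) (u v : ext A) (q r : nat).

(** Exactness of the rows needs a splitting of the exterior algebra by subcomplexes
    of I_i^+ and I_i^-.  The map for the sign - is induced by a map of A; the one
    for + is its complement, and not induced by multiplication by P_i. *)
Definition ext_cut i b u : ext A :=
  let w := ext_map (lmul (proj k n i false)) u in if b then u - w else w.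

Lemma ext_cut_linear i b : linear (ext_cut i b).
Proof.
move=> a u v; rewrite /ext_cut linearP; case: b => //=.
by rewrite scalerBr opprD addrACA.
Qed.

Lemma ext_cut_id i u : ext_cut i true u + ext_cut i false u = u.
Proof. by rewrite /ext_cut subrK. Qed.

Lemma CE_ext_cut i b j e r u : CE (ideal j e) r u -> CE (ideal j e) r (ext_cut i b u).
Proof.
move=> Ju; have Jw : CE (ideal j e) r (ext_map (lmul (proj k n i false)) u).
  by apply: CE_ext_map => // x Jx; apply: ideal_mul; right.
by rewrite /ext_cut; case: b => //; apply: (subspaceB (CE_subspace _ _)).
Qed.

Lemma CE_ext_cut_im i b r u : CE setT r u -> CE (ideal i b) r (ext_cut i b u).
Proof.
move=> Tu; case: b; rewrite /ext_cut; last first.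
  by apply: CE_ext_map_im => // x; apply: ideal_mul; left; apply: ideal_proj.
apply: CE_ext_map_compl => // [|x]; first exact: ideal_subspace.
rewrite /= /lmul /proj mulrBl mul1r opprB addrC subrK.
by apply: ideal_mul; left; apply: (ideal_proj k n i true).
Qed.

Lemma Xpart_subspace q i s : subspace (@Xpart k n i s q).
Proof.
have sCE e := CE_subspace (ideal i e) q : subspace (CE (@ideal k n i e) q).
case: s => [e|] /=; first exact: sCE.
split=> [|a u v [u1 u2] [v1 v2]]; first by split; apply: subspace0 (sCE _).
by split; apply: (sCE _).2.
Qed.

Lemma Xpart_CE q i s v : Xpart i s q v -> CE setT q v.
Proof.
have H e : CE (ideal i e) q v -> CE setT q v by apply: CE_mono.
by case: s => [e /H|[/H]].
Qed.

Lemma Xpart_cut q i b j s v : Xpart j s q v -> Xpart j s q (ext_cut i b v).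
Proof. by case: s => [e|[v1 v2]]; [|split]; exact: CE_ext_cut. Qed.

Lemma Xpart_cut_im q i b v : CE setT q v -> Xpart i (Some b) q (ext_cut i b v).
Proof. exact: CE_ext_cut_im. Qed.

Lemma Xpart_ce_diff q i s v : Xpart i s q.+1 v -> Xpart i s q (ce_diff v).
Proof.
have H e : CE (ideal i e) q.+1 v -> CE (ideal i e) q (ce_diff v).
  by apply: CE_diff; apply: ideal_lie.
by case: s => [e /H|[/H v1 /H v2]].
Qed.

Lemma Tbc_exact_rows : (0 < n)%N -> exact_rows_bicomplex (Tbc k n) n.
Proof.
move=> n0.
pose X q i s := @Xpart k n i s q.
have sX q i s : subspace (X q i s) by apply: Xpart_subspace.
have XN q i v : X q i None v <-> X q i (Some true) v /\ X q i (Some false) v by [].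
have XT q i s v : X q i s v -> CE setT q v by apply: Xpart_CE.
have Xc q i b j s v : X q j s v -> X q j s (ext_cut i b v) by apply: Xpart_cut.
have Xi q i b v : CE setT q v -> X q i (Some b) (ext_cut i b v) by apply: Xpart_cut_im.
have sT q := CE_subspace setT q : subspace (CE [set: A] q).
have cl := ext_cut_linear; have ci := ext_cut_id.
apply: ExactRowsBicomplex.
- by case=> [|p] q; [exact: sT | exact: (row_part_subspace (sX q) p)].
- by case=> [|p]; [exact: row_aug_is_linear | exact: row_d_is_linear].
- case=> [|p]; first exact: ce_diff_is_linear.
  by move=> a x y; apply/ffunP => s; rewrite !ffunE linearP.
- case=> [|p] q x; first exact: (row_aug_part (sX q) (sT q) (XT q) n0).
  exact: (row_d_part (sX q) (XN q)).
- case=> [|p] q x; first by apply: CE_diff; apply: lie_ideal_setT.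
  move=> Px s; rewrite ffunE; have := Px s; case: ifP => _ H; last by rewrite H linear0.
  by move=> i; apply/Xpart_ce_diff/H.
- case=> [|p] x; first exact: CE_diff1.
  move=> Px; apply/ffunP => s; rewrite !ffunE; apply: (@CE_diff1 _ _ setT).
  exact: (Xpart_CE (row_partE (sX 1%N) s (Ordinal n0) Px)).
- by case=> [|p] x; [exact: row_aug_d | exact: row_dd].
- case=> [|p] x; first exact: ce_diffK.
  by apply/ffunP => s; rewrite !ffunE ce_diffK.
- case=> [|p] x.
    rewrite /= [RHS]linear_sum; apply: eq_bigr => e _.
    by rewrite linearZ /= ffunE.
  apply/ffunP => s; rewrite !ffunE linear_sum; apply: eq_bigr => e _.
  by rewrite linearZ /= ffunE.
- move=> q x Tx.
  exact: (row_surj cl ci (sX q) (XT q) (Xc q) (Xi q) Tx).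
- case=> [|p] q x Px dx.
    exact: (row_exact0 cl ci (sX q) (sT q) (XN q) (XT q)
      (Xc q) (Xi q) Px dx).
  exact: (row_exactS cl ci (sX q) (sT q) (XN q) (XT q)
      (Xc q) (Xi q) Px dx).
- by case=> [|p] q x // np Px; apply: (@row_last _ _ _ (X q) p x np Px).
Qed.

End Rows.

(** * Cut chains *)

Section DeletionSums.
Variables (k : fieldType) (A : eqType) (x0 : A) (V : lmodType k).
Implicit Types (w l : seq A) (F G : A -> seq A -> V).

Definition omit (j : nat) w := take j w ++ drop j.+1 w.

(** Contraction of an exterior product of the entries of w, with the coefficients
    given by F; del_sum_del_sum is the anticommutativity of contractions. *)
Definition del_sum F w : V :=
  \sum_(j < size w) (-1) ^+ j *: F (nth x0 w j) (omit j w).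

Lemma size_omit j w : (j < size w)%N -> size (omit j w) = (size w).-1.
Proof. by move=> lt; rewrite size_cat size_drop size_take lt; lia. Qed.

Lemma mem_omit j w x : x \in omit j w -> x \in w.
Proof. by rewrite mem_cat => /orP[/mem_take | /mem_drop]. Qed.

Lemma del_sum_nil F : del_sum F [::] = 0.
Proof. exact: big_ord0. Qed.

Lemma del_sum_cons F x w :
  del_sum F (x :: w) = F x w - del_sum (fun y l => F y (x :: l)) w.
Proof.
rewrite /del_sum /= big_ord_recl /= expr0 scale1r /omit /= drop0; congr (_ + _).
by rewrite -sumrN; apply: eq_bigr => j _; rewrite exprS mulN1r scaleNr.
Qed.

Lemma eq_del_sum F G w :
  (forall j, (j < size w)%N ->
     F (nth x0 w j) (omit j w) = G (nth x0 w j) (omit j w)) ->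
  del_sum F w = del_sum G w.
Proof. by move=> FG; apply: eq_bigr => j _; rewrite FG. Qed.

Lemma eq_del_sum_ext F G w : (forall x l, F x l = G x l) -> del_sum F w = del_sum G w.
Proof. by move=> FG; apply: eq_del_sum. Qed.

Lemma eq_del_sum_mem F G w :
  (forall x l, x \in w -> {subset l <= w} -> size l = (size w).-1 -> F x l = G x l) ->
  del_sum F w = del_sum G w.
Proof.
move=> FG; apply: eq_del_sum => j lt; apply: FG; first exact: mem_nth.
  by move=> x; apply: mem_omit.
exact: size_omit.
Qed.

Lemma del_sum_lin a F G w :
  del_sum (fun x l => a *: F x l + G x l) w = a *: del_sum F w + del_sum G w.
Proof.
rewrite /del_sum scaler_sumr -big_split; apply: eq_bigr => j _ /=.
by rewrite scalerDr !scalerA mulrC.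
Qed.

Lemma del_sum0 w : del_sum (fun _ _ => 0) w = 0.
Proof. by apply: big1 => j _; rewrite scaler0. Qed.

Lemma del_sumD F G w :
  del_sum (fun x l => F x l + G x l) w = del_sum F w + del_sum G w.
Proof.
by rewrite -[del_sum F w]scale1r -del_sum_lin; apply: eq_del_sum => j _; rewrite scale1r.
Qed.

Lemma del_sumZ a F w : del_sum (fun x l => a *: F x l) w = a *: del_sum F w.
Proof.
rewrite -[RHS]addr0 -(del_sum0 w) -del_sum_lin.
by apply: eq_del_sum => j _; rewrite addr0.
Qed.

Lemma del_sum_sum (I : Type) (r : seq I) (P : pred I) (F : I -> A -> seq A -> V) w :
  del_sum (fun x l => \sum_(i <- r | P i) F i x l) w =
  \sum_(i <- r | P i) del_sum (F i) w.
Proof.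
rewrite exchange_big /=; apply: eq_bigr => j _; exact: scaler_sumr.
Qed.

Lemma del_sum_subspace (B : set V) F w : subspace B ->
  (forall x l, x \in w -> {subset l <= w} -> size l = (size w).-1 -> B (F x l)) ->
  B (del_sum F w).
Proof.
move=> sB BF; apply: (subspace_sum sB) => j _; apply: (subspaceZ sB).
apply: BF; [exact: mem_nth | by move=> x; apply: mem_omit | exact: size_omit].
Qed.

(** Deleting two entries in the two possible orders gives opposite signs. *)
Lemma del_sum_del_sum (F : A -> A -> seq A -> V) w :
  {in w &, forall x y l, F x y l = F y x l} ->
  del_sum (fun x l => del_sum (F x) l) w = 0.
Proof.
elim: w F => [|x w IH] F Fsym; first exact: del_sum_nil.
rewrite del_sum_cons.
have -> : del_sum (fun y l => del_sum (F y) (x :: l)) w = del_sum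
    (fun y l => -1 *: del_sum (fun z l' => F y z (x :: l')) l + F y x l) w.
  by apply: eq_del_sum => j _; rewrite del_sum_cons addrC scaleN1r.
rewrite del_sum_lin IH => [|y z yw zw l]; last by apply: Fsym; rewrite inE ?yw ?zw orbT.
rewrite scaler0 add0r; apply/eqP; rewrite subr_eq0; apply/eqP.
by apply: eq_del_sum_mem => y l yw _ _; apply: Fsym; rewrite inE ?eqxx // yw orbT.
Qed.

End DeletionSums.

Lemma linear_del_sum (k : fieldType) (A : eqType) (x0 : A) (V W : lmodType k)
  (f : {linear V -> W}) (F : A -> seq A -> V) w :
  f (del_sum x0 F w) = del_sum x0 (fun x l => f (F x l)) w.
Proof. by rewrite /del_sum linear_sum; apply: eq_bigr => j _; rewrite linearZ. Qed.

Section CutChains.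
Variables (k : fieldType) (A : algType k) (P : nat -> A).
Implicit Types (a b f : A) (w : seq A) (s : nat -> option bool) (e : bool) (i m : nat).
Local Notation dsum := (del_sum (0 : A)).

Definition cutp m e : A := if e then P m else 1 - P m.

(** The commutator [ad f, P m] of operators on A. *)
Definition ad_cut m f a : A := lbr f (P m * a) - P m * lbr f a.

Lemma ad_cut_lin m f c a b : ad_cut m f (c *: a + b) = c *: ad_cut m f a + ad_cut m f b.
Proof.
rewrite /ad_cut mulrDr -scalerAr !lbrDr mulrDr -scalerAr opprD.
by rewrite addrACA -scalerBr.
Qed.

Lemma lbrZ f c a : lbr f (c *: a) = c *: lbr f a.
Proof. by rewrite /lbr -scalerAr -scalerAl scalerBr. Qed.

Lemma lbrBr f a b : lbr f (a - b) = lbr f a - lbr f b.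
Proof. by rewrite addrC -scaleN1r lbrDr scaleN1r addrC. Qed.

(** The same commutator serves for both signs because [ad f, 1 - P] = - [ad f, P]. *)
Lemma lbr_cutp m e f a :
  lbr f (sg k e *: (cutp m e * a)) = ad_cut m f a + sg k e *: (cutp m e * lbr f a).
Proof.
rewrite lbrZ /ad_cut /cutp; case: e; rewrite /sg ?scale1r ?subrK //.
rewrite !scaleN1r !mulrBl !mul1r lbrBr !opprB.
by rewrite [RHS]addrA subrK.
Qed.

(** Each side equals (ad g ad f) P a - P (ad g ad f) a, and ad f commutes with
    ad g. *)
Lemma ad_cutC m f g a : lbr f g = 0 ->
  lbr g (ad_cut m f a) + ad_cut m g (lbr f a) =
  lbr f (ad_cut m g a) + ad_cut m f (lbr g a).
Proof.
move=> fg; have C b : lbr f (lbr g b) = lbr g (lbr f b).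
  by apply/eqP; rewrite -subr_eq0 -lbr_jacobi fg /lbr mul0r mulr0 subrr.
have H x y : lbr y (ad_cut m x a) + ad_cut m y (lbr x a) =
    lbr y (lbr x (P m * a)) - P m * lbr y (lbr x a).
  by rewrite /ad_cut [lbr y (_ - P m * _)]lbrBr addrA subrK.
by rewrite !H !C.
Qed.

(** The places are processed from m - 1 down to 0.  The sign of a deletion counts the
    entries behind the deleted one: then deleting the entries of w in the order in
    which a permutation assigns them to the places m - 1, .., 0 contributes the sign
    of the permutation. *)
Fixpoint cut_chain s m a w : ext A :=
  match m with
  | 0 => wedge (a :: w)
  | m'.+1 => match s m' with
    | Some e => cut_chain s m' (sg k e *: (cutp m' e * a)) w
    | None => (-1) ^+ (size w).+1 *:
        dsum (fun f l => cut_chain s m' (ad_cut m' f a) l) w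
    end
  end.

Lemma cut_chain_lin s m c a b w :
  cut_chain s m (c *: a + b) w = c *: cut_chain s m a w + cut_chain s m b w.
Proof.
elim: m a b w => [|m IH] a b w /=; first exact: (wedgeP [::]).
case: (s m) => [e|].
  by rewrite mulrDr scalerDr -scalerAr scalerA mulrC -scalerA IH.
under eq_del_sum_ext do rewrite ad_cut_lin IH.
by rewrite del_sum_lin scalerDr !scalerA mulrC.
Qed.

Lemma cut_chainD s m a b w :
  cut_chain s m (a + b) w = cut_chain s m a w + cut_chain s m b w.
Proof. by rewrite -[a]scale1r cut_chain_lin !scale1r. Qed.

Lemma eq_cut_chain s s' m a w : (forall i, (i < m)%N -> s i = s' i) ->
  cut_chain s m a w = cut_chain s' m a w.
Proof.
elim: m a w => //= m IH a w ss'; rewrite ss' //.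
have {}IH b l : cut_chain s m b l = cut_chain s' m b l.
  by apply: IH => i lt; apply/ss'/ltnW.
by case: (s' m) => [e|]; rewrite ?IH //; under eq_del_sum_ext do rewrite IH.
Qed.

Definition setn s i (u : option bool) : nat -> option bool :=
  fun j => if j == i then u else s j.

Definition zeros_between s i m := (\sum_(j < m) (i < j) && (s j == None))%N.

Lemma zeros_betweenS s i m : (i < m)%N ->
  zeros_between s i m.+1 = (zeros_between s i m + (s m == None))%N.
Proof. by move=> im; rewrite /zeros_between big_ord_recr /= im. Qed.

Lemma zeros_between_last s m : zeros_between s m m.+1 = 0%N.
Proof.
by apply: big1 => j _; rewrite ltnNge -ltnS ltn_ord.
Qed.

Lemma ce_diff_comm w : {in w &, forall x y, lbr x y = 0} -> ce_diff (wedge w) = 0.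
Proof.
move=> cw; rewrite ce_diff_wedge big1 // => j _; rewrite big1 // => i _.
rewrite cw ?wedge0 ?scaler0 ?mem_nth //.
exact: ltn_trans (ltn_ord i) (ltn_ord j).
Qed.

(** Only the brackets with the coefficient a survive. *)
Lemma ce_diff_wedge_comm a w : {in w &, forall x y, lbr x y = 0} ->
  ce_diff (wedge (a :: w)) = dsum (fun f l => wedge (lbr f a :: l)) w.
Proof.
move=> cw; rewrite -ext_consE ce_diff_cons ce_diff_comm // linear0 oppr0 sub0r.
rewrite /lie_der ext_lift_wedge; last exact: ce_ad_compat.
rewrite ce_adE -sumrN; apply: eq_bigr => j _; rewrite -scalerN; congr (_ *: _).
rewrite (lbrN a) -scaleN1r -[LHS]addr0 -(wedge0 (del j w)) -scaleN1r.
by rewrite -(wedgeP [::]) addr0 /=.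
Qed.

Definition row_sum s m a w : ext A :=
  \sum_(i < m | s i != None) (-1) ^+ zeros_between s i m *:
    cut_chain (setn s i None) m a w.

(** Moving the differential through a chain replaces, by lbr_cutp, a sign by a
    zero, until it meets the coefficient a.  It passes the zeros with a sign: two
    successive applications of ad are antisymmetrized by the deletions, and
    commuting elements have commuting ad. *)
Lemma ce_diff_cut_chain s m a w : {in w &, forall x y, lbr x y = 0} ->
  ce_diff (cut_chain s m a w) =
  (-1) ^+ (size w).+1 *: row_sum s m a w + dsum (fun f l => cut_chain s m (lbr f a) l) w.
Proof.
elim: m a w => [|m IH] a w cw.
  by rewrite /row_sum big_ord0 scaler0 add0r ce_diff_wedge_comm.
have rowS : row_sum s m.+1 a w = (if s m is Some e then
      row_sum s m (sg k e *: (cutp m e * a)) w +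
      (-1) ^+ (size w).+1 *: dsum (fun f l => cut_chain s m (ad_cut m f a) l) w
    else (-1) ^+ (size w) *: dsum (fun f l => row_sum s m (ad_cut m f a) l) w).
  rewrite /row_sum big_mkcond big_ord_recr /= zeros_between_last expr0 scale1r.
  rewrite {4}/setn eqxx -!big_mkcond.
  have setnm (i : 'I_m) : setn s i None m = s m by rewrite /setn gtn_eqF.
  case sm : (s m) => [e|] /=.
    congr (_ + _ *: _); last first.
      apply: eq_del_sum_ext => f l; apply: eq_cut_chain => i im.
      by rewrite /setn ltn_eqF.
    by apply: eq_bigr => i _; rewrite setnm sm zeros_betweenS // sm addn0.
  rewrite addr0 del_sum_sum scaler_sumr; apply: eq_bigr => i _.
  rewrite setnm sm zeros_betweenS // sm addn1 del_sumZ !scalerA; congr (_ *: _).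
  by rewrite !exprS !mulN1r mulrNN mulrC.
have signK (v : ext A) : (-1) ^+ (size w).+1 *: ((-1) ^+ (size w).+1 *: v) = v.
  by rewrite scalerA -expr2 sqrr_sign scale1r.
rewrite rowS /=; case sm : (s m) => [e|].
  rewrite IH // scalerDr signK -addrA; congr (_ + _).
  by rewrite -del_sumD; apply: eq_del_sum_ext => f l; rewrite lbr_cutp cut_chainD.
rewrite linearZ linear_del_sum /=.
have size_l (f : A) (l : seq A) : f \in w -> size l = (size w).-1 -> (size l).+1 = size w.
  by case: (w) => // x w' _ ->.
under (@eq_del_sum_mem _ _ _ _ (fun f l => ce_diff _)) => f l fw lw sl.
  rewrite IH; last by move=> x y /lw xw /lw yw; apply: cw.
  rewrite (size_l f) //.
  over.
rewrite del_sum_lin scalerDr; congr (_ + _).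
under [RHS](@eq_del_sum_mem _ _ _ _ (fun f l => (-1) ^+ (size l).+1 *: _)) => f l fw _ sl.
  rewrite (size_l f) //.
  over.
rewrite del_sumZ exprS mulN1r scaleNr -scalerN; congr (_ *: _).
apply/esym/eqP; rewrite -addr_eq0 addrC -del_sumD.
under eq_del_sum_ext => f l.
  rewrite -del_sumD.
  under eq_del_sum_ext do rewrite -cut_chainD.
  over.
apply/eqP/del_sum_del_sum => f g fw gw l.
by rewrite ad_cutC // cw.
Qed.


Section Membership.
Variable Id : nat -> bool -> set A.
Hypothesis Id_sub : forall i e, subspace (Id i e).
Hypothesis Id_mul : forall i e a b, Id i e a \/ Id i e b -> Id i e (a * b).
Hypothesis Id_cutp : forall i e, Id i e (cutp i e).

Definition zeros s m := (\sum_(j < m) (s j == None))%N.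

Lemma Id_lbr i e a b : Id i e b -> Id i e (lbr a b).
Proof. by move=> Ib; apply: (subspaceB (Id_sub _ _)); apply: Id_mul; [right | left]. Qed.

Lemma Id_ad_cut i e m f a : Id i e a -> Id i e (ad_cut m f a).
Proof.
move=> Ia; apply: (subspaceB (Id_sub _ _)).
  by apply: Id_lbr; apply: Id_mul; right.
by apply: Id_mul; right; apply: Id_lbr.
Qed.

Lemma Id_ad_cut_im i e f a : Id i e (ad_cut i f a).
Proof.
have -> : ad_cut i f a =
    lbr f (sg k e *: (cutp i e * a)) - sg k e *: (cutp i e * lbr f a).
  by rewrite lbr_cutp addrK.
apply: (subspaceB (Id_sub _ _)); rewrite ?lbrZ; apply: (subspaceZ (Id_sub _ _)).
  by apply: Id_lbr; apply: Id_mul; left.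
by apply: Id_mul; left.
Qed.

Lemma CE_cut_chain i e s m a w r : Id i e a -> (r + zeros s m = (size w).+1)%N ->
  CE (Id i e) r (cut_chain s m a w).
Proof.
elim: m a w r => [|m IH] a w r Ia; rewrite /zeros ?big_ord0 ?big_ord_recr /=.
  by rewrite addn0 => ->; apply: CE_wedge.
case: (s m) => [c|] /=; rewrite ?addn0 ?addn1 => rE.
  by apply: IH rE; apply: (subspaceZ (Id_sub _ _)); apply: Id_mul; right.
apply: (subspaceZ (CE_subspace _ _)); apply: del_sum_subspace (CE_subspace _ _) _.
move=> f l fw _ sl; apply: IH; first exact: Id_ad_cut.
by move: fw rE; rewrite sl; case: (w) => // x w' _; rewrite addnS => -[].
Qed.

(** The chain lies in the subcomplex of the ideal of a place as soon as that place
    has been processed. *)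
Lemma CE_cut_chain_im i e s m a w r : (i < m)%N -> s i = None \/ s i = Some e ->
  (r + zeros s m = (size w).+1)%N -> CE (Id i e) r (cut_chain s m a w).
Proof.
elim: m a w r => // m IH a w r; rewrite ltnS leq_eqVlt => /predU1P[->|im] si;
  rewrite /zeros big_ord_recr /=.
  case: si => -> /=; rewrite ?addn0 ?addn1 => rE.
    apply: (subspaceZ (CE_subspace _ _)); apply: del_sum_subspace (CE_subspace _ _) _.
    move=> f l fw _ sl; apply: CE_cut_chain; first exact: Id_ad_cut_im.
    by move: fw rE; rewrite sl; case: (w) => // x w' _; rewrite addnS => -[].
  apply: CE_cut_chain => //; apply: (subspaceZ (Id_sub _ _)).
  by apply: Id_mul; left.
case: (s m) => [c|] /=; rewrite ?addn0 ?addn1 => rE; first exact: IH.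
apply: (subspaceZ (CE_subspace _ _)); apply: del_sum_subspace (CE_subspace _ _) _.
move=> f l fw _ sl; apply: IH => //.
by move: fw rE; rewrite sl; case: (w) => // x w' _; rewrite addnS => -[].
Qed.

End Membership.

(** ** Chains without zeros *)

Section SumOverSigns.
Variable n : nat.

(** The order is the one in which cut_chain processes the places, so that
    sum_agree_cons removes one of them at each step. *)
Fixpoint places_below m : seq 'I_n :=
  if m is m'.+1 then
    if insub m' is Some i then i :: places_below m' else places_below m'
  else [::].

Lemma mem_places_below m (i : 'I_n) : (i \in places_below m) = (i < m)%N.
Proof.
elim: m => //= m IH; case: insubP => [j _ jm|nm].
  by rewrite inE IH ltnS [(i <= m)%N]leq_eqVlt -jm.
rewrite IH ltnS [RHS]leq_eqVlt; case: eqP => // im.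
by rewrite -im ltn_ord in nm.
Qed.

Definition nat_signs (s : {ffun 'I_n -> option bool}) : nat -> option bool :=
  fun m => if insub m is Some i then s i else None.

Lemma uniq_places_below m : uniq (places_below m).
Proof.
elim: m => //= m IH; case: insubP => // i _ im /=.
by rewrite IH mem_places_below im ltnn.
Qed.

Lemma prod_places_below (F : 'I_n -> k) : \prod_(i <- places_below n) F i = \prod_i F i.
Proof.
rewrite -[RHS]big_enum /=; apply/perm_big/uniq_perm; rewrite ?enum_uniq ?uniq_places_below //.
by move=> i; rewrite mem_places_below ltn_ord mem_enum.
Qed.

Lemma nat_signsE (s : {ffun 'I_n -> option bool}) (i : 'I_n) : nat_signs s i = s i.
Proof. by rewrite /nat_signs valK. Qed.

Lemma sum_cut_chain_agree m (e0 : {ffun 'I_n -> bool}) a w : (m <= n)%N ->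
  \sum_(e | agree_off (places_below m) e0 e)
    (\prod_(i <- places_below m) sg k (e i)) *:
      cut_chain (nat_signs (signed e)) m a w = wedge (a :: w).
Proof.
elim: m e0 a => [|m IH] e0 a mn /=; first by rewrite sum_agree_nil big_nil scale1r.
rewrite insubT; set i := Sub m mn : 'I_n.
have ir : i \notin places_below m by rewrite mem_places_below ltnn.
rewrite sum_agree_cons // big_bool.
have H (b : bool) : \sum_(e | agree_off (places_below m) (setf e0 i b) e)
    (\prod_(j <- i :: places_below m) sg k (e j)) *: (cut_chain (nat_signs (signed e)) m.+1 a w)
    = wedge (cutp m b * a :: w).
  rewrite -[RHS]scale1r -[X in _ = X *: _](_ : sg k b * sg k b = 1); last first.
    by rewrite /sg; case: b; rewrite ?mulr1 // mulrNN mulr1.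
  have Z (c : k) x l : wedge (c *: x :: l) = c *: wedge (x :: l) :> ext A.
    by have := wedgeP [::] l c x 0; rewrite addr0 /= wedge0 addr0.
  rewrite -scalerA -Z -(IH (setf e0 i b)) ?(ltnW mn) // scaler_sumr.
  apply: eq_bigr => e /forallP/(_ i); rewrite (negPf ir) setfE /= => /eqP ei.
  by rewrite big_cons -scalerA -[m in nat_signs _ m]/(val i) nat_signsE ffunE ei.
rewrite !H; have := wedgeP [::] w 1 (P m * a) ((1 - P m) * a).
by rewrite !scale1r /= => <-; rewrite -mulrDl addrC subrK mul1r.
Qed.

(** In each place the two signs contribute P and 1 - P, whose sum is 1. *)
Lemma sum_cut_chain a w :
  \sum_(e : {ffun 'I_n -> bool}) (\prod_i sg k (e i)) *:
    cut_chain (nat_signs (signed e)) n a w = wedge (a :: w).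
Proof.
rewrite -(sum_cut_chain_agree [ffun=> true] a w (leqnn n)).
rewrite [RHS](eq_bigl xpredT) => [|e]; last first.
  suff -> : agree_off (places_below n) [ffun=> true] e by [].
  by apply/forallP => i; rewrite mem_places_below ltn_ord.
by apply: eq_bigr => e _; rewrite prod_places_below.
Qed.

End SumOverSigns.
End CutChains.

(** * Evaluation of the chain with zeros in all places *)

(** A permutation is determined by the image of the last index and the permutation
    induced on the others. *)
Lemma sum_lift_perm (V : nmodType) (m : nat) (F : 'S_m.+1 -> V) :
  \sum_pi F pi = \sum_(j < m.+1) \sum_(sigma : 'S_m) F (lift_perm ord_max j sigma).
Proof.
rewrite pair_big /=; pose h (p : 'I_m.+1 * 'S_m) := lift_perm ord_max p.1 p.2.
have h_inj : injective h.
  move=> [j s] [j' s'] /permP e; have := e ord_max; rewrite !lift_perm_id => jj'.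
  congr (_, _) => //; apply/permP => i; have := e (fintype.lift ord_max i).
  by rewrite !lift_perm_lift jj' => /lift_inj.
rewrite (reindex h) //; apply: onW_bij; apply: inj_card_bij h_inj _.
by rewrite card_prod !card_ord !card_Sn.
Qed.

Lemma eq_foldr (S T : Type) (f g : S -> T -> T) z r : f =2 g -> foldr f z r = foldr g z r.
Proof. by move=> fg; elim: r => //= x r ->. Qed.

Section Evaluation.
Variables (k : fieldType) (A : algType k) (P : nat -> A).
Implicit Types (a f : A) (w : seq A).

Lemma nth_omit (x0 : A) w (j i : nat) : (j < size w)%N ->
  nth x0 (omit j w) i = nth x0 w (bump j i).
Proof.
move=> lt; rewrite nth_cat size_take lt /bump; case: ltnP => [ij|ji].
  by rewrite nth_take.
by rewrite nth_drop; congr nth; lia.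
Qed.

(** The first deletion determines the value of the permutation at the last place, and
    the number of entries behind the deleted one has the parity by which lift_perm
    changes the sign. *)
Lemma ext1_cut_chain_None m a w : size w = m ->
  ext1 (cut_chain P (fun=> None) m a w) = \sum_(pi : 'S_m) (-1) ^+ pi *:
    foldr (fun (i : 'I_m) g => ad_cut P i w`_(pi i) g) a (enum 'I_m).
Proof.
elim: m a w => [|m IH] a w sw.
  rewrite (size0nil sw) /= ext1_wedge (big_pred1 1%g) => [|s].
    by rewrite odd_perm1 expr0 scale1r (size0nil (size_enum_ord 0)).
  by apply/esym/eqP/permP => -[].
rewrite /= linearZ linear_del_sum /= /del_sum sw sum_lift_perm scaler_sumr.
apply: eq_bigr => j _; have jw : (j < size w)%N by rewrite sw.
rewrite IH ?size_omit ?sw // !scaler_sumr; apply: eq_bigr => s _.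
rewrite odd_lift_perm enum_ordSr foldr_rcons foldr_map lift_perm_id !scalerA.
congr (_ *: _).
  by rewrite [RHS]signr_addb signr_addb !signr_odd /= !exprS !mulN1r opprK.
apply: eq_foldr => i g; rewrite nth_omit //.
have iE : widen_ord (leqnSn m) i = fintype.lift ord_max i.
  by apply: val_inj; rewrite /= /bump leqNgt ltn_ord.
by rewrite iE lift_perm_lift -iE.
Qed.

(** The summand of the residue formula in one place, summed over its sign. *)
Lemma sum_cutp f m g :
  \sum_b sg k b *: (cutp P m (~~ b) * lbr f (cutp P m b * g)) = ad_cut P m f g.
Proof.
rewrite big_bool /= /sg scale1r scaleN1r /ad_cut /cutp.
have -> : lbr f ((1 - P m) * g) = lbr f g - lbr f (P m * g).
  by rewrite mulrBl mul1r lbrBr.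
rewrite [P m * (_ - _)]mulrBr opprB [X in X + _]mulrBl mul1r.
by rewrite addrA subrK.
Qed.

Lemma sum_foldr_agree (n : nat) (F : 'I_n -> A) a (r : seq 'I_n) gam0 : uniq r ->
  \sum_(gam | agree_off r gam0 gam) (\prod_(i <- r) sg k (gam i)) *:
    foldr (fun (i : 'I_n) g =>
      cutp P i (~~ gam i) * lbr (F i) (cutp P i (gam i) * g)) a r =
  foldr (fun (i : 'I_n) g => ad_cut P i (F i) g) a r.
Proof.
elim: r gam0 => [|i r IH] gam0 /=; first by rewrite sum_agree_nil big_nil scale1r.
case/andP=> ir ur; rewrite sum_agree_cons // -sum_cutp; apply: eq_bigr => b _.
rewrite -(IH (setf gam0 i b)) // mulr_sumr.
have lbr_sum (I : Type) (s : seq I) (Q : pred I) (G : I -> A) f :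
    lbr f (\sum_(j <- s | Q j) G j) = \sum_(j <- s | Q j) lbr f (G j).
  by rewrite /lbr mulr_sumr mulr_suml -sumrB.
rewrite lbr_sum mulr_sumr scaler_sumr; apply: eq_bigr => gam /forallP/(_ i).
rewrite (negPf ir) setfE /= => /eqP gi.
by rewrite big_cons gi -scalerAr lbrZ -scalerAr scalerA.
Qed.

End Evaluation.

Lemma residueE (k : fieldType) (n : nat) (f : 'I_n.+1 -> laurent k n) :
  let w := [seq mulop (f (fintype.lift ord0 i)) | i <- enum 'I_n] in
  residue f = (-1) ^+ n *
    tr (ext1 (cut_chain (fun m => place n m (cut k)) (fun=> None) n (mulop (f ord0)) w)).
Proof.
move=> w; have sw : size w = n by rewrite size_map -cardE card_ord.
rewrite (ext1_cut_chain_None _ _ sw).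
rewrite /residue; congr (_ * tr _); apply: eq_bigr => pi _; congr (_ *: _).
pose F (i : 'I_n) := mulop (f (fintype.lift ord0 (pi i))).
have wE (i : 'I_n) : w`_(pi i) = F i.
  by rewrite (nth_map (pi i)) ?size_enum_ord // nth_ord_enum.
transitivity (foldr (fun (i : 'I_n) g => ad_cut (fun m => place n m (cut k)) i (F i) g)
    (mulop (f ord0)) (enum 'I_n)); last by apply: eq_foldr => i g; rewrite wE.
rewrite -(sum_foldr_agree _ F _ [ffun=> true] (enum_uniq 'I_n)) sum_agree_enum.
by apply: eq_bigr => gam _; rewrite big_enum.
Qed.

(** * The zigzag of a symbol *)

Lemma sdeg_None (n : nat) : sdeg ([ffun=> None] : {ffun 'I_n -> option bool}) = n.+1.
Proof.
rewrite /sdeg; congr _.+1; rewrite -[RHS]card_ord; apply: eq_card => i.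
by rewrite !inE ffunE.
Qed.

Section SymbolZigzag.
Variables (k : fieldType) (n : nat) (f : 'I_n.+1 -> laurent k n).
Hypothesis n_gt0 : (0 < n)%N.
Local Notation A := (Emx k n).
Local Notation P := (fun m => place n m (cut k)).
Local Notation sgn := {ffun 'I_n -> option bool}.
Implicit Types (s : sgn) (c : k) (p : nat).

Let f0 : A := mulop (f ord0).
Let w : seq A := [seq mulop (f (fintype.lift ord0 i)) | i <- enum 'I_n].

Let size_w : size w = n. Proof. by rewrite size_map -cardE card_ord. Qed.

Let w_comm : {in w &, forall x y, lbr x y = 0}.
Proof. by move=> _ _ /mapP[i _ ->] /mapP[j _ ->]; apply: mulop_comm. Qed.

Lemma zeros_nat_signs s : zeros (nat_signs s) n = (sdeg s).-1.
Proof.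
rewrite /sdeg /zeros -sum1_card [RHS]big_mkcond; apply: eq_bigr => i _.
by rewrite nat_signsE inE; case: ifP.
Qed.

Lemma zeros_between_nat_signs s (i : 'I_n) :
  zeros_between (nat_signs s) i n = zeros_above s i.
Proof.
rewrite /zeros_above /zeros_between -sum1_card [RHS]big_mkcond; apply: eq_bigr => j _.
by rewrite nat_signsE inE; case: ifP.
Qed.

(** The power of -1 compensates the sign (-1)^(n+1) that ce_diff_cut_chain produces in
    each column; it is 1 in the last column, where its exponent is n (n + 1). *)
Definition symbol_chain c p : bc_col (Tbc k n) p :=
  match p return Tcol k n p with
  | 0 => c *: wedge (f0 :: w)
  | p'.+1 => [ffun s : sgn => if sdeg s == p'.+1
      then (c * (-1) ^+ (n.+1 * p')) *: cut_chain P (nat_signs s) n f0 w else 0]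
  end.

Lemma symbol_chain_row_sum s :
  ce_diff (cut_chain P (nat_signs s) n f0 w) = (-1) ^+ n.+1 *:
    \sum_(i | s i != None) (-1) ^+ zeros_above s i *:
      cut_chain P (nat_signs (setf s i None)) n f0 w.
Proof.
rewrite (ce_diff_cut_chain _ _ _ _ w_comm) size_w.
rewrite [X in _ + X](_ : _ = 0) ?addr0.
  congr (_ *: _); rewrite /row_sum; apply: eq_big => [i|i _]; first by rewrite nat_signsE.
  rewrite zeros_between_nat_signs; congr (_ *: _); apply: eq_cut_chain => j jn.
  rewrite /setn -[j]/(val (Ordinal jn)) !nat_signsE ffunE val_eqE.
  by case: eqP.
rewrite -(del_sum0 0 _ w); apply: eq_del_sum_mem => g l /mapP[i _ ->] _ _.
rewrite mulop_comm.
by have := cut_chain_lin P (nat_signs s) n (-1) 0 0 l; rewrite scaler0 addr0 scaleN1r addNr.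
Qed.

Lemma symbol_chain_part c p : (p <= n)%N ->
  bc_part (Tbc k n) p.+1 (n.+1 - p) (symbol_chain c p.+1).
Proof.
move=> pn s; rewrite ffunE; case: eqP => // sp i.
have H e : s i = None \/ s i = Some e ->
    CE (ideal i e) (n.+1 - p) (cut_chain P (nat_signs s) n f0 w).
  move=> si; apply: (CE_cut_chain_im (Id := @ideal k n)).
  - exact: ideal_subspace.
  - by move=> j b x y; apply: ideal_mul.
  - exact: ideal_proj.
  - exact: ltn_ord.
  - by rewrite nat_signsE.
  by rewrite zeros_nat_signs sp size_w subnK // leqW.
apply: subspaceZ; first exact: Xpart_subspace.
move: H; case: (s i) => [e|] H.
  by apply: H; right.
by split; apply: H; left.
Qed.

Lemma symbol_chain_h c p : (0 < p)%N ->
  bc_h (symbol_chain c p.+1) = bc_v (symbol_chain c p).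
Proof.
case: p => // p _; apply/ffunP => s; rewrite !ffunE.
case: eqP => sp; last first.
  rewrite linear0 big1 // => i si; rewrite ffunE sdeg_set // eqSS.
  by case: eqP => [/sp //|_]; rewrite scaler0.
rewrite linearZ /= symbol_chain_row_sum scalerA mulnS -mulrA -exprD addnC.
rewrite scaler_sumr; apply: eq_bigr => i si; rewrite ffunE sdeg_set // sp eqxx.
by rewrite !scalerA mulrC.
Qed.

Lemma symbol_chain_aug c : bc_h (symbol_chain c 1) = c *: wedge (f0 :: w).
Proof.
rewrite -(sum_cut_chain P n) scaler_sumr; apply: eq_bigr => e _.
rewrite ffunE; have -> : sdeg [ffun i => Some (e i)] = 1%N.
  by rewrite /sdeg eq_card0 // => i; rewrite !inE ffunE.
by rewrite eqxx muln0 expr0 mulr1 !scalerA mulrC.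
Qed.

Lemma symbol_chain_zigzag c : zigzag n.+1 1 n.+2 (symbol_chain c).
Proof.
split=> [[|p] // pn|p /andP[p0 _]]; last exact: symbol_chain_h.
have lpn : (p <= n)%N by move: pn; rewrite /= ltnS.
by rewrite ltnS (leqW lpn) subSS; apply: symbol_chain_part.
Qed.

Lemma symbol_chain_last c : ext1 (symbol_chain c n.+1 [ffun=> None]) =
  c *: ext1 (cut_chain P (fun=> None) n f0 w).
Proof.
rewrite ffunE sdeg_None.
have -> : (-1) ^+ (n.+1 * n) = 1 :> k.
  by rewrite -signr_odd oddM /= andNb expr0.
rewrite eqxx mulr1 linearZ /=; congr (_ *: ext1 _); apply: eq_cut_chain => i lt.
by rewrite -[i]/(val (Ordinal lt)) nat_signsE ffunE.
Qed.

End SymbolZigzag.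

(** * The trace of the last differential *)

Section TraceOfPage.
Variables (k : fieldType) (n : nat).
Hypothesis n_gt0 : (0 < n)%N.
Local Notation A := (Emx k n).
Local Notation C := (Tbc k n).
Local Notation sgn := {ffun 'I_n -> option bool}.

(** The only multi-sign of degree n + 1 is constantly 0. *)
Lemma Tpart_None q (x : {ffun sgn -> ext A}) (i : 'I_n) e :
  bc_part C n.+1 q x -> CE (ideal i e) q (x [ffun=> None]).
Proof.
move=> /(_ [ffun=> None]); rewrite sdeg_None eqxx => /(_ i); rewrite ffunE.
by case: e => -[].
Qed.

Lemma Tpart_Itr (x : {ffun sgn -> ext A}) :
  bc_part C n.+1 1 x -> Itr (ext1 (x [ffun=> None])).
Proof.
move=> Px i; have H e : ideal i e (ext1 (x [ffun=> None])).
  by apply: ext1_CE; [apply: ideal_subspace | apply: Tpart_None].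
by split.
Qed.

Lemma trH0_vpi (z : A) : Itr z -> trH0 (vpi (@comm_Itr k n) z) = tr z.
Proof.
move=> Iz; rewrite /trH0; have [b Bb ->] := repr_vpi (@comm_Itr k n) z.
suff [Ib tb] : Itr b /\ tr b = 0 by rewrite trD // tb addr0.
apply: (span_min (B := [set b | Itr b /\ tr b = 0])) Bb.
  split=> [|a x y [Ix tx] [Iy ty]];
    first by split; [apply: subspace0 (Itr_subspace _ _) | apply: tr0].
  split; first exact: (Itr_subspace _ _).2.
  by rewrite tr_lin // tx ty mulr0 addr0.
move=> _ [x [g [Ix ->]]]; apply: tr_lbr => i e; left.
by have [] := Ix i; case: e.
Qed.

(** rho1 and toH0 both pass to representatives; this changes an element of the last
    column by vertical boundaries, on which the trace vanishes. *)
Lemma trH0_rho1 (x : {ffun sgn -> ext A}) : bc_part C n.+1 1 x ->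
  trH0 (rho1 (ss_pi C n.+1 n.+1 1 x)) = tr (ext1 (x [ffun=> None])).
Proof.
move=> Px; rewrite /rho1 /toH0 /ss_edge /ss_pi.
have E := Tbc_exact_rows k n_gt0.
have [b /(span_ss_B_last E (ltn0Sn _))[y Py ->] ->] := repr_vpi (@ss_B k C n.+1 n.+1 1) x.
have [b' /(span_ss_B_last E (ltn0Sn _))[y' Py' ->] ->] :=
  repr_vpi (@ss_B k C 1 n.+1 1) (x + bc_v y).
have [I1 t1] := tr_ce_diff n_gt0 (fun i e => Tpart_None i e Py).
have [I2 t2] := tr_ce_diff n_gt0 (fun i e => Tpart_None i e Py').
have Ix := Tpart_Itr Px.
have -> : (x + bc_v y + bc_v y' : {ffun sgn -> ext A}) [ffun=> None] =
    x [ffun=> None] + ce_diff ((y : {ffun sgn -> ext A}) [ffun=> None]) +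
    ce_diff ((y' : {ffun sgn -> ext A}) [ffun=> None]).
  by rewrite !ffunE.
have extD (u v w : ext A) : ext1 (u + v + w) = ext1 u + ext1 v + ext1 w.
  by rewrite !linearD.
rewrite extD trH0_vpi; last by do 2?apply: (subspaceD (Itr_subspace _ _)).
rewrite !trD ?t1 ?t2 ?addr0 //.
exact: (subspaceD (Itr_subspace _ _)).
Qed.

(** A boundary of the first page in column 0 is a vertical boundary, and remains a
    boundary on all pages. *)
Lemma rho2_pi (x : ext A) :
  rho2 (ss_pi C 1 0 n.+1 x) = ss_pi C n.+1 0 n.+1 x.
Proof.
rewrite /rho2 /ss_edge /ss_pi.
have E := Tbc_exact_rows k n_gt0.
have [b Bb ->] := repr_vpi (@ss_B k C 1 0 n.+1) x.
apply/vpi_eq; rewrite addrC addKr.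
apply: span_min Bb; first exact: span_subspace.
move=> b' [y [th [Py _ /= th1 ->]]]; apply: span_mem.
have h1 : @bc_h k C 0 (th 1%N) = 0.
  by rewrite th1; apply: (linear0 (@row_aug k n (ext A))).
have := ss_B_vertical E n.+1 Py; congr (@ss_B k C n.+1 0 n.+1 _).
by rewrite -[LHS]addr0; congr (_ + _).
Qed.

End TraceOfPage.

Theorem theorem5 (k : fieldType) (n : nat) (hn : (0 < n)%N) :
  set_bij (ss_page (Tbc k n) n.+1 n.+1 1) (ss_page (Tbc k n) n.+1 0 n.+1)
    (@dlast k n) /\
  forall f : 'I_n.+1 -> laurent k n,
    ss_page (Tbc k n) 1 0 n.+1 (kappa f) /\
    trH0 (rho1 (dlast_inv (rho2 ((-1) ^+ n *: kappa f)))) = residue f.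
Proof.
have E := Tbc_exact_rows k hn; have bij := ss_d_last_bij E hn.
split=> // f; pose f0 := mulop (f ord0).
pose w := [seq mulop (f (fintype.lift ord0 i)) | i <- enum 'I_n].
have wE : [seq mulop (f i) | i <- enum 'I_n.+1] = f0 :: w.
  by rewrite enum_ordSl /= -map_comp.
have szw : size w = n by rewrite size_map -cardE card_ord.
split.
  apply/ss_page0P; exists (wedge (f0 :: w)); split.
  - by have := @CE_wedge k _ setT f0 w I; rewrite szw.
  - rewrite -wE; apply: ce_diff_comm => _ _ /mapP[i _ ->] /mapP[j _ ->].
    exact: mulop_comm.
  - by rewrite /kappa wE.
have th := symbol_chain_zigzag f ((-1) ^+ n).
have Pth : bc_part (Tbc k n) n.+1 1 (symbol_chain f ((-1) ^+ n) n.+1).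
  by have := symbol_chain_part f ((-1) ^+ n) (leqnn n); rewrite subSnn.
(* The symbol is the start of its zigzag, so that the inverse of the differential
   gives the class of the last term. *)
have -> : (-1) ^+ n *: kappa f =
    ss_pi (Tbc k n) 1 0 n.+1 (bc_h (symbol_chain f ((-1) ^+ n) 1)).
  by rewrite symbol_chain_aug /kappa wE /ss_pi linearZ.
rewrite rho2_pi // -(ss_d_last E hn th) /dlast_inv pinvKV; last 2 first.
- exact: set_bij_inj bij.
- by rewrite inE; apply/(ss_page_lastP E); exists (symbol_chain f ((-1) ^+ n)).
have Itr_chain : Itr (ext1 (symbol_chain f 1 n.+1 [ffun=> None])).
  by apply: Tpart_Itr; have := symbol_chain_part f 1 (leqnn n); rewrite subSnn.
rewrite symbol_chain_last scale1r in Itr_chain.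
by rewrite trH0_rho1 // symbol_chain_last residueE trZ.
Qed.
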